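(* Let $\mathbf{u} = (u(n))_{n=1}^\infty$ be a simple non-degenerate integer linear recurrence sequence of order $d \ge 2$ with a dominant root. Then, for any fixed integer $s \ge 1$, uniformly over integers $M$ with \[ M \ge \exp\left(N \log_3 N / \log_2 N\right), \] we have \[ \mathsf{M}_s^*(M,N) \le N^{s-1+o(1)}, \] where $o(1)$ denotes a quantity tending to $0$ as $N \to \infty$ at a rate depending only on $s$ and $\mathbf{u}$ (and not on $M$). That is, for every $\varepsilon > 0$ there is $N_0 = N_0(\varepsilon, s, \mathbf{u})$ such that $\mathsf{M}_s^*(M,N) \le N^{s-1+\varepsilon}$ for all integers $N \ge N_0$ and all integers $M \ge \exp(N \log_3 N/\log_2 N)$.
   Context: An integer linear recurrence sequence of order $d \ge 1$ is a sequence of integers $\mathbf{u} = (u(n))_{n=1}^\infty$ satisfying a relation $u(n+d) = c_{d-1}u(n+d-1) + \cdots + c_0 u(n)$ for all $n = 1, 2, \ldots$, with integer coefficients $c_0, \ldots, c_{d-1}$, and not satisfying any shorter relation of this form. Its characteristic polynomial is $f(X) = X^d - c_{d-1}X^{d-1} - \cdots - c_0 \in \mathbb{Z}[X]$. The sequence is non-degenerate if there are no roots of unity among the ratios of distinct (complex) roots of $f$; here it is understood that these ratios are defined, i.e. $c_0 \ne 0$. The sequence is simple if $f$ has no multiple roots. It has a dominant root if $f$ has a root $\lambda$ with $|\lambda| > \max\{|\mu| : f(\mu) = 0,\ \mu \ne \lambda\}$. Nonzero complex numbers $\gamma_1, \ldots, \gamma_s$ are multiplicatively dependent if there exist integers $k_1,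 \ldots, k_s$, not all zero, such that $\gamma_1^{k_1} \cdots \gamma_s^{k_s} = 1$. They are multiplicatively dependent of maximal rank if they are multiplicatively dependent and no proper (nonempty) sub-tuple of $(\gamma_1, \ldots, \gamma_s)$ is multiplicatively dependent. For integers $M \ge 0$, $N \ge 1$, $s \ge 1$, $\mathsf{M}_s^*(M,N)$ denotes the number of $s$-tuples $(n_1, \ldots, n_s) \in (\mathbb{Z} \cap [M+1, M+N])^s$ such that $u(n_1), \ldots, u(n_s)$ (all nonzero) are multiplicatively dependent of maximal rank. $\log_k$ is the $k$-fold iterated natural logarithm: for $x \ge 1$, $\log_1 x = \log x$ and $\log_k x = \log_{k-1}\left(\max\{\log x, 2\}\right)$ for $k = 2, 3, \ldots$. *)

(* Defs.v *)
From HB Require Import structures.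
From mathcomp Require Import all_boot all_order all_algebra.
From mathcomp Require Import all_classical all_reals all_analysis.
From mathcomp Require Export complex.

Set Implicit Arguments.
Unset Strict Implicit.
Unset Printing Implicit Defensive.

Import Order.TTheory GRing.Theory Num.Theory.
Local Open Scope ring_scope.
Local Open Scope complex_scope.

(* Sequences are indexed by n >= 1; the value u 0 is never used. *)
Definition satisfies_recurrence (u : nat -> int) (d : nat) (c : 'I_d -> int) :
    Prop :=
  forall n : nat, (1 <= n)%N -> u (n + d)%N = \sum_(i < d) c i * u (n + i)%N.

Definition linear_recurrence (u : nat -> int) (d : nat) (c : 'I_d -> int) :
    Prop :=
  [/\ (1 <= d)%N,
      satisfies_recurrence u c
    & forall (e : nat) (c' : 'I_e -> int),
        (1 <= e)%N -> (e < d)%N -> ~ satisfies_recurrence u c'].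

Definition char_poly_rec (d : nat) (c : 'I_d -> int) : {poly int} :=
  'X^d - \sum_(i < d) c i *: 'X^i.

Section RootConditions.

Variables (R : realType) (f : {poly int}).

Let fC : {poly R[i]} := map_poly intr f.

(* For a characteristic polynomial, f`_0 = - c_0, so f`_0 != 0 says that 0 is
   not a root and the ratios of roots are defined. *)
Definition nondegenerate_roots : Prop :=
  f`_0 != 0 /\
  forall a b : R[i], root fC a -> root fC b -> a != b ->
    forall n : nat, (0 < n)%N -> (a / b) ^+ n != 1.

Definition simple_roots : Prop :=
  forall a : R[i], root fC a -> mup a fC = 1%N.

Definition has_dominant_root : Prop :=
  exists2 a : R[i], root fC a &
    forall b : R[i], root fC b -> b != a -> `|b| < `|a|.

End RootConditions.

Section MultiplicativeDependence.

Variables (F : fieldType) (s : nat) (g : 'I_s -> F).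

(* Multiplicative dependence of the sub-tuple (g i), i in J.  Its entries are
   required to be nonzero because 0 ^ k is total for negative k. *)
Definition mult_dependent (J : {set 'I_s}) : Prop :=
  (forall i, i \in J -> g i != 0) /\
  exists k : 'I_s -> int,
    (exists2 i, i \in J & k i != 0) /\ \prod_(i in J) g i ^ k i = 1.

Definition mult_dependent_max_rank : Prop :=
  mult_dependent [set: 'I_s] /\
  forall J : {set 'I_s}, J != finset.set0 -> J \proper [set: 'I_s] ->
    ~ mult_dependent J.

End MultiplicativeDependence.

(* Tuples of naturals at most M + N with all entries at least M + 1. *)
Definition count_max_rank (R : realType) (u : nat -> int) (s M N : nat) : nat :=
  #|[set n : s.-tuple 'I_(M + N).+1 |
      [forall i, (M + 1 <= tnth n i)%N] &&
      `[< mult_dependent_max_rank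
            (fun i : 'I_s => (u (tnth n i))%:~R : R[i]) >]]|.

(* log_k x = iter_log k x for k >= 1; the value x at k = 0 is a dummy. *)
Fixpoint iter_log (R : realType) (k : nat) (x : R) : R :=
  match k with
  | 0 => x
  | 1 => ln x
  | k'.+1 => iter_log k' (Num.max (ln x) 2)
  end.

(* Main.v *)
Require Import Defs.
From HB Require Import structures.
From mathcomp Require Import all_boot all_order all_algebra.
From mathcomp Require Import all_classical all_reals all_analysis.
From mathcomp Require Import zify ring lra fingroup perm.

Set Implicit Arguments.
Unset Strict Implicit.
Unset Printing Implicit Defensive.

(* Linear forms in logarithms are avoided.  Write d for the order and g for the
   gcd of u(M), ..., u(M+d-1), which divides every u(M+h); put
   a_h = |u(M+h)| / g.  Since g^d divides the Hankel determinant of the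
   sequence at M, which grows like |c_0|^M, and |c_0| < |lambda|^d by dominance
   (d >= 2), every a_h is exponentially large in M.

   If p^e divides a_h for d indices h <= N, then p^e divides the determinant of
   the coefficient vectors of X^h modulo f, an integer of size exp(O(N)).  By a
   uniform zero estimate (Strassmann's theorem, with non-degeneracy) more than
   Z indices always contain d with nonvanishing determinant.  So for T indices
   a single integer D = exp(O(N)) is such that v_p(a_h) > v_p(D) for at most Z
   of them, for every prime p.  As M is much larger than N, it follows that
   each a_h has a large gcd with boundedly many others only, hence r+1 of the
   T numbers have pairwise small gcds when T is large.  In a multiplicative
   relation among these r+1 numbers, the one with the largest exponent would
   divide the product of its gcds with the others, which is smaller than it.

   So boundedly many terms u(M+h), h <= N, lie in the saturation of a
   multiplicative group of rank s - 1.  In a tuple of maximal rank n_1 is of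
   this kind for the group generated by the other u(n_i), which gives
   O(N^(s-1)) tuples. *)

Import Order.TTheory GRing.Theory Num.Theory.
Local Open Scope ring_scope.

(** * Strassmann's theorem *)

Lemma monic_factor_uniq_roots (A : idomainType) (p : {poly A}) (rs : seq A) :
  all (root p) rs -> uniq rs ->
  exists q : {poly A}, p = q * \prod_(z <- rs) ('X - z%:P).
Proof.
elim: rs p => [|a rs IH] p /=; first by exists p; rewrite big_nil mulr1.
case/andP=> /factor_theorem[q ->] qrs /andP[a_rs rs_uniq].
have /IH[// | q' ->] : all (root q) rs.
  apply/allP => z z_rs; have := allP qrs _ z_rs.
  rewrite rootM root_XsubC => /orP[//|/eqP za].
  by rewrite -za z_rs in a_rs.
by exists q'; rewrite big_cons mulrA mulrAC.
Qed.

(** Legendre's sum for k without its first term k/p is the sum for k/p, truncated one step earlier;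
    hence the induction on the truncation length, made independent of k. *)
Lemma logn_fact_le (p k : nat) : prime p -> (p.-1 * logn p k`! <= k)%N.
Proof.
move=> p_pr; have p_gt1 := prime_gt1 p_pr; rewrite logn_fact //.
move: k.+1 => m; elim: m k => [|m IH] k; first by rewrite big_geq ?muln0.
case: m IH => [|m] IH; first by rewrite big_geq ?muln0.
rewrite big_nat_recl // expn1.
under eq_bigr do rewrite expnS divnMA.
have := IH (k %/ p)%N; have := leq_divM k p; nia.
Qed.

(** Falling factorials are monic over every ring, so degrees can still be read off after reduction
    modulo p. *)
Definition fallp (A : nzRingType) (k : nat) : {poly A} :=
  \prod_(i < k) ('X - (i%:R)%:P).

Lemma size_fallp (A : nzRingType) k : size (fallp A k) = k.+1.
Proof. by rewrite /fallp size_prod_XsubC /index_enum -enumT size_enum_ord. Qed.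

Lemma horner_fallp (h k : nat) : (fallp int k).[h%:R] = (h ^_ k)%:R :> int.
Proof.
rewrite /fallp horner_prod.
under eq_bigr do rewrite !hornerE.
elim: k => [|k IH]; first by rewrite big_ord0 ffactn0.
rewrite big_ord_recr /= IH ffactnSr natrM.
case: (leqP k h) => [kh|hk]; first by rewrite natrB.
by rewrite ffact_small // !mul0r.
Qed.

(* Strassmann's theorem for the p-adic power series interpolating
   h |-> sum_k 'C(h, k) p^k b_k, with p-adic numbers avoided: up to a factor
   prime to p, the partial sums are integer combinations of falling
   factorials, and dividing these by the largest possible power of p leaves
   a polynomial of degree less than n modulo p. *)
Lemma strassmann (p n : nat) (b : nat -> int) (hs : seq nat) :
    prime p -> (n.+1 < p)%N ->
    (exists2 l, (l < n)%N & ~~ (p %| b l)%Z) ->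
    uniq hs ->
    (forall h, h \in hs -> \sum_(k < h.+1) 'C(h, k)%:R * p%:R ^+ k * b k = 0) ->
  (size hs < n)%N.
Proof.
move=> p_pr np [l0 l0n pbl0] hs_uniq hs0; have p_gt1 := prime_gt1 p_pr.
have p_gt0 := prime_gt0 p_pr.
have PoszX k : (p ^ k)%N%:Z = p%:Z ^+ k by rewrite -!natz natrX.
pose H := maxn n (\max_(h <- hs) h).
have leH h : h \in hs -> (h <= H)%N.
  by move=> hhs; rewrite leq_max orbC (leq_bigmax_seq _ hhs).
(* The factor [H'] clears the prime-to-p denominators of all p^k / k! with k <= H, so that [al k] is
   the integer H' p^k / k!. Its p-adic valuation is exactly k for k < n, and at least n for n <= k
   <= H. *)
pose H' := partn H`! p^'.
have H'gt0 : (0 < H')%N by rewrite part_gt0.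
have pH' : coprime p H'.
  by rewrite prime_coprime // -p'natE //; apply: part_pnat.
pose al k := (H' * p ^ k %/ k`!)%N.
have alK k : (k <= H)%N -> (al k * k`! = H' * p ^ k)%N.
  move=> kH; rewrite divnK //.
  rewrite -(partnC p (fact_gt0 k)) Gauss_dvd; last first.
    exact: coprime_partC.
  apply/andP; split.
    apply: dvdn_mull; rewrite p_part; apply: dvdn_exp2l.
    have := logn_fact_le k p_pr; nia.
  apply: dvdn_mulr; apply: partn_dvd; first exact: fact_gt0.
  rewrite (fact_split kH); exact: dvdn_mulr.
have al_small k : (k < n)%N -> logn p (al k) = k.
  move=> kn; have kH : (k <= H)%N by rewrite leq_max (ltnW kn).
  have := congr1 (logn p) (alK _ kH).
  have al0 : (0 < al k)%N.
    have : (0 < al k * k`!)%N by rewrite alK // muln_gt0 H'gt0 expn_gt0 p_gt0.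
    by rewrite muln_gt0 => /andP[].
  rewrite !lognM ?fact_gt0 ?expn_gt0 ?p_gt0 // pfactorK //.
  rewrite (logn_coprime pH') add0n.
  have := logn_fact_le k p_pr; nia.
have al_gt0 k : (k <= H)%N -> (0 < al k)%N.
  move=> kH; have : (0 < al k * k`!)%N by rewrite alK //
    muln_gt0 H'gt0 expn_gt0 p_gt0.
  by rewrite muln_gt0 => /andP[].
have al_big k : (n <= k)%N -> (k <= H)%N -> (p ^ n %| al k)%N.
  move=> nk kH; rewrite pfactor_dvdn ?al_gt0 //.
  have := congr1 (logn p) (alK _ kH).
  rewrite !lognM ?fact_gt0 ?expn_gt0 ?p_gt0 ?al_gt0 // pfactorK //.
  rewrite (logn_coprime pH') add0n.
  have := logn_fact_le k p_pr; nia.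
(* The least such e is the minimum of k + v_p(b_k) over k < n; it is below n because of [l0]. *)
pose P e := [exists k : 'I_n, ~~ (p%:Z ^+ e.+1 %| p%:Z ^+ k * b k)%Z].
have exP : exists e, P e.
  exists l0; apply/existsP; exists (Ordinal l0n) => /=.
  by rewrite exprSr dvdz_mul2l ?expf_neq0 //; lia.
case: (ex_minnP exP) => e Pe e_min.
have e_lt : (e < n)%N.
  apply: leq_ltn_trans (l0n); apply: e_min; apply/existsP.
  by exists (Ordinal l0n) => /=; rewrite exprSr dvdz_mul2l ?expf_neq0 //; lia.
have e_all k : (k < n)%N -> (p%:Z ^+ e %| p%:Z ^+ k * b k)%Z.
  move=> kn; case: e {Pe e_lt} e_min => [|e] e_min;
    first by rewrite expr0 dvd1z.
  apply: contraT => nd.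
  have /e_min : P e by apply/existsP; exists (Ordinal kn).
  by rewrite ltnn.
(* [K] will be the last index below n at which this minimum is attained; it becomes the degree
   modulo p. *)
pose Q k := (k < n)%N && ~~ (p%:Z ^+ e.+1 %| p%:Z ^+ k * b k)%Z.
have exQ : exists k, Q k.
  by case/existsP: Pe => k ?; exists k; rewrite /Q ltn_ord.
have ubQ k : Q k -> (k <= n)%N by case/andP => /ltnW.
case: (ex_maxnP exQ ubQ) => K /andP[Kn Knd] K_max.
have al_fac k : (k < n)%N -> exists2 a : nat, coprime p a & al k = (a * p ^
  k)%N.
  move=> kn; have kH : (k <= H)%N by rewrite leq_max (ltnW kn).
  exists (partn (al k) p^'); last first.
    by rewrite -{1}(partnC p (al_gt0 _ kH)) p_part al_small // mulnC.
  by rewrite prime_coprime // -p'natE //; apply: part_pnat.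
pose A k := (al k)%:Z * b k.
have A_dvd k : (k <= H)%N -> (p%:Z ^+ e %| A k)%Z.
  move=> kH; case: (ltnP k n) => kn.
    have [a _ eal] := al_fac _ kn.
    by rewrite /A eal PoszM -mulrA; apply: dvdz_mull; rewrite PoszX e_all.
  apply: dvdz_mulr; apply: (@dvdz_trans (p ^ n)%N); last exact: al_big.
  by rewrite PoszX; apply: dvdz_exp2l; apply: ltnW.
(* Since [al k] times k! is H' p^k, at h in [hs] the value p^e F(h) is H' times the given sum; the
   terms with h < k <= H vanish with the falling factorial. *)
pose F : {poly int} := \sum_(k < H.+1) (A k %/ p%:Z ^+ e)%Z *: fallp int k.
have rootF h : h \in hs -> root F h%:R.
  move=> hhs; rewrite /root /F horner_sum.
  have pe0 : p%:Z ^+ e != 0 by rewrite expf_neq0 //; lia.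
  rewrite -(inj_eq (mulfI pe0)) mulr0 mulr_sumr.
  apply/eqP; transitivity (H'%:Z * \sum_(k < h.+1) 'C(h, k)%:R * p%:R ^+ k * b
    k);
    last by rewrite hs0 // mulr0.
  have hH : (h.+1 <= H.+1)%N by rewrite ltnS leH.
  rewrite (big_ord_widen _ (fun k => 'C(h, k)%:R * p%:R ^+ k * b k) hH).
  rewrite [in RHS]big_mkcond [RHS]mulr_sumr; apply: eq_bigr => k _ /=.
  rewrite hornerZ horner_fallp mulrA [p%:Z ^+ e * _]mulrC divzK; last first.
    by apply: A_dvd; rewrite -ltnS.
  case: ltnP => hk; last by rewrite ffact_small // !mulr0.
  rewrite -bin_ffact natrM /A.
  have := congr1 Posz (alK k (ltn_ord k)).
  rewrite !PoszM PoszX !natz => alE.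
  transitivity ((H'%:Z * p%:Z ^+ k) * ('C(h, k)%:Z * b k)); last by ring.
  by rewrite -alE; ring.
have [|| q Fq] := @monic_factor_uniq_roots int F [seq h%:R | h <- hs].
- by apply/allP => _ /mapP[h hhs ->]; apply: rootF.
- by rewrite map_inj_uniq // => x y; rewrite !natz => -[].
have pchar_p := pchar_Fp p_pr.
pose f := intr : int -> 'F_p.
have Fdvd z : (p %| z)%Z = (f z == 0) by rewrite (dvdz_pcharf pchar_p).
pose Fp := map_poly f F.
have sizeFp : size Fp = K.+1.
  have KH : (K < H.+1)%N by rewrite ltnS leq_max (ltnW Kn).
  have divpe z : (p%:Z ^+ e %| z)%Z ->
      (f (z %/ p%:Z ^+ e)%Z == 0) = (p%:Z ^+ e.+1 %| z)%Z.
    move=> ez; rewrite -Fdvd -{2}(divzK ez) exprS dvdz_mul2r //.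
    by rewrite expf_neq0 //; lia.
  have fK : f (A K %/ p%:Z ^+ e)%Z != 0.
    rewrite divpe ?A_dvd //; apply: contra Knd.
    have [a pa eal] := al_fac _ Kn.
    rewrite /A eal PoszM -mulrA PoszX (@Gauss_dvdzr _ a%:Z) //.
    by rewrite coprimezE abszX coprimeXl.
  have fbig k : (K < k <= H)%N -> f (A k %/ p%:Z ^+ e)%Z = 0.
    case/andP=> Kk kH; apply/eqP; rewrite divpe ?A_dvd //.
    case: (ltnP k n) => kn.
      have [a _ eal] := al_fac _ kn.
      rewrite /A eal PoszM -mulrA PoszX; apply: dvdz_mull.
      apply: contraT => nd; have /K_max : Q k by rewrite /Q kn.
      by rewrite leqNgt Kk.
    apply: dvdz_mulr; apply: (@dvdz_trans (p ^ n)%N); last exact: al_big.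
    by rewrite PoszX; apply: dvdz_exp2l.
  have KH1 : (K.+1 <= H.+1)%N by [].
  have map_fallp k : map_poly f (fallp int k) = fallp 'F_p k.
    rewrite /fallp rmorph_prod /=; apply: eq_bigr => i _.
    by rewrite map_polyXsubC /f rmorph_nat.
  have -> : Fp = \sum_(k < K.+1) f (A k %/ p%:Z ^+ e)%Z *: fallp 'F_p k.
    rewrite (big_ord_widen _
      (fun k => f (A k %/ p%:Z ^+ e)%Z *: fallp 'F_p k) KH1) big_mkcond /=.
    rewrite /Fp /F rmorph_sum; apply: eq_bigr => k _ /=.
    rewrite map_polyZ map_fallp; case: ltnP => // Kk.
    rewrite [X in X *: _](_ : _ = 0) ?scale0r //; apply: fbig.
    by rewrite Kk -ltnS ltn_ord.
  rewrite big_ord_recr /= addrC size_polyDl size_scale // size_fallp //.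
  apply: leq_trans (size_sum _ _ _) _; apply/bigmax_leqP => k _.
  apply: leq_trans (size_scale_leq _ _) _.
  by rewrite size_fallp.
(* The roots are split off over the integers, where they are distinct, and their monic product keeps
   its degree modulo p; congruences among the roots do no harm. *)
have : (size hs < size Fp)%N.
  have Fp0 : Fp != 0 by rewrite -size_poly_eq0 sizeFp.
  move: Fp0; rewrite /Fp Fq rmorphM rmorph_prod /=.
  under eq_bigr do rewrite map_polyXsubC.
  have mon : \prod_(i <- [seq h%:R | h <- hs]) ('X - (f i)%:P) \is monic.
    exact: monic_prod_XsubC.
  rewrite mulf_eq0 negb_or => /andP[q0 _].
  rewrite size_Mmonic // -(big_map f xpredT (fun i => 'X - i%:P)).
  rewrite size_prod_XsubC !size_map addnS /=.
  by rewrite -[(size hs).+1]add1n leq_add2r lt0n size_poly_eq0.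
by rewrite sizeFp ltnS => /leq_ltn_trans; apply.
Qed.

(** * Recurrence sequences and companion matrices *)

(** Indices start at 0 here; the given sequence, indexed from 1, enters as y n = u (n + 1). *)
Definition recur (A : nzRingType) (n : nat) (c : 'I_n -> A) (y : nat -> A) :=
  forall m, y (m + n)%N = \sum_(i < n) c i * y (m + i)%N.

Lemma Vandermonde_unit (F : fieldType) (n : nat) (z : 'I_n -> F) :
  injective z -> Vandermonde n (\row_j z j) \in unitmx.
Proof.
move=> z_inj; rewrite unitmxE det_Vandermonde unitfE.
apply/prodf_neq0 => i _; apply/prodf_neq0 => l il.
rewrite !mxE subr_eq0 (inj_eq z_inj) eq_sym.
by case: ltngtP il => // /ltn_eqF/negbT.
Qed.

Lemma exp_indep (F : fieldType) (n : nat) (z B : 'I_n -> F) :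
  injective z -> (forall i, (i < n)%N -> \sum_j B j * z j ^+ i = 0) ->
  forall j, B j = 0.
Proof.
move=> z_inj B0 j.
pose V := Vandermonde n (\row_j z j).
have Vunit : V \in unitmx := Vandermonde_unit z_inj.
have : V *m (\col_j B j) = 0.
  apply/matrixP => i l; rewrite !mxE -[RHS](B0 i) //.
  by apply: eq_bigr => l' _; rewrite !mxE mulrC.
by move/(congr1 (mulmx (invmx V))); rewrite mulKmx // mulmx0 =>
  /matrixP/(_ j 0); rewrite !mxE.
Qed.

(** Inverting the Vandermonde matrix fits the first n values; the recurrence, shared by the powers
    of each z_j, propagates the formula. *)
Lemma binet (F : fieldType) (n : nat) (c z : 'I_n -> F) (y : nat -> F) :
    injective z -> (forall j, z j ^+ n = \sum_(i < n) c i * z j ^+ i) ->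
    recur c y ->
  exists A : 'I_n -> F, forall m, y m = \sum_j A j * z j ^+ m.
Proof.
move=> z_inj z_root y_rec.
pose V := Vandermonde n (\row_j z j).
have Vunit : V \in unitmx := Vandermonde_unit z_inj.
pose A := invmx V *m \col_i y i.
exists (fun j => A j 0) => m.
elim/ltn_ind: m => m IH; case: (ltnP m n) => mn.
  have : (V *m A) (Ordinal mn) 0 = y m by rewrite mulKVmx // mxE.
  by rewrite !mxE => <-; apply: eq_bigr => j _; rewrite !mxE mulrC.
rewrite -(subnK mn) y_rec.
under eq_bigr => i _.
  rewrite IH; last by rewrite -[X in (_ < X)%N](subnK mn) ltn_add2l.
  rewrite mulr_sumr; over.
rewrite exchange_big; apply: eq_bigr => j _ /=.
rewrite exprD z_root !mulr_sumr; apply: eq_bigr => i _.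
by rewrite exprD; ring.
Qed.

Section CharPolyRec.

Variables (k : nat) (c : 'I_k.+1 -> int).

Let low : {poly int} := \sum_(i < k.+1) c i *: 'X^i.

Let size_low : (size low < size ('X^(k.+1) : {poly int})%R)%N.
Proof.
rewrite size_polyXn ltnS; apply: leq_trans (size_sum _ _ _) _.
apply/bigmax_leqP => i _; apply: leq_trans (size_scale_leq _ _) _.
by rewrite size_polyXn.
Qed.

Lemma monic_char_poly_rec : char_poly_rec c \is monic.
Proof.
by rewrite monicE /char_poly_rec lead_coefDl ?size_polyN // lead_coefXn.
Qed.

Lemma size_char_poly_rec : size (char_poly_rec c) = k.+2.
Proof. by rewrite /char_poly_rec size_polyDl ?size_polyN // size_polyXn. Qed.

End CharPolyRec.

Section Companion.

Variables (k : nat) (c : 'I_k.+1 -> int).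

Definition compan : 'M[int]_k.+1 :=
  \matrix_(i, j) if i == ord_max then c j else (j == i.+1 :> nat)%:R.

Lemma compan_lt (phi : 'cV_k.+1) (i : nat) (ik : (i < k)%N) :
  (compan *m phi) (inord i) 0 = phi (inord i.+1) 0.
Proof.
have i_max : (inord i == ord_max :> 'I_k.+1) = false.
  by rewrite -val_eqE /= inordK ?ltn_eqF // ltnW.
rewrite mxE (bigD1 (inord i.+1)) //= big1 => [|j ji].
  by rewrite mxE i_max !inordK ?eqxx ?mul1r ?addr0 // ltnW.
rewrite mxE i_max inordK ?(ltnW ik) //; last exact: ltnW.
by case: (eqVneq (j : nat) i.+1) ji => [e|_]; rewrite ?mul0r //
  -val_eqE /= inordK // e eqxx.
Qed.

Lemma compan_max (phi : 'cV_k.+1) :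
  (compan *m phi) ord_max 0 = \sum_j c j * phi j 0.
Proof. by rewrite mxE; apply: eq_bigr => j _; rewrite mxE eqxx. Qed.

Lemma companX_row0 (phi : 'cV_k.+1) (i : nat) : (i <= k)%N ->
  (compan ^+ i *m phi) ord0 0 = phi (inord i) 0.
Proof.
elim: i phi => [|i IH] phi ik.
  by rewrite expr0 mul1mx; congr (phi _ _); apply/val_inj; rewrite /= inordK.
by rewrite exprSr -mulmxA IH ?(ltnW ik) // compan_lt.
Qed.

(** Row 0 of [compan ^+ h] is the coefficient vector of X^h modulo the characteristic polynomial;
    paired with initial values phi it gives the h-th term of the solution that starts with phi. *)
Lemma recur_compan (phi : 'cV_k.+1) :
  recur c (fun h => (compan ^+ h *m phi) ord0 0).
Proof.
move=> m; rewrite addnS -addSn addnC exprD -mulmxA companX_row0 //.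
rewrite (_ : inord k = ord_max); last by apply/val_inj; rewrite /= inordK.
rewrite exprS -mulmxA compan_max; apply: eq_bigr => j _.
rewrite addnC exprD -mulmxA companX_row0 -1?ltnS //.
by rewrite inord_val.
Qed.

Definition state (y : nat -> int) (m : nat) : 'cV[int]_k.+1 :=
  \col_i y (m + i)%N.

Lemma compan_state y m : recur c y -> compan *m state y m = state y m.+1.
Proof.
move=> y_rec; apply/matrixP => i l; rewrite (ord1 l) {l}.
have [-> | i_k] := eqVneq i ord_max.
  rewrite compan_max !mxE /= addSnnS y_rec.
  by apply: eq_bigr => j _; rewrite mxE.
have ik : (i < k)%N by rewrite ltn_neqAle -ltnS ltn_ord andbT.
by rewrite -{1}(inord_val i) compan_lt // !mxE inordK // addSnnS.
Qed.

Lemma companX_state y m h : recur c y ->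
  compan ^+ h *m state y m = state y (m + h)%N.
Proof.
move=> y_rec; elim: h => [|h IH]; first by rewrite addn0 expr0 mul1mx.
by rewrite exprS -mulmxA IH compan_state // addnS.
Qed.

Lemma state_compan (phi : 'cV_k.+1) :
  state (fun h => (compan ^+ h *m phi) ord0 0) 0 = phi.
Proof.
apply/matrixP => i l; rewrite (ord1 l) mxE add0n companX_row0 -1?ltnS //.
by rewrite inord_val.
Qed.

Lemma absz_det_compan : `|\det compan|%N = `|c ord0|%N.
Proof.
rewrite (expand_det_col _ ord0) (bigD1 ord_max) //= big1 ?addr0; last first.
  by move=> i /negbTE i_max; rewrite mxE i_max mul0r.
rewrite mxE eqxx /cofactor (_ : row' _ _ = 1%:M) ?det1 ?mulr1.
  by rewrite abszM abszX /= exp1n muln1.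
apply/matrixP => i j; rewrite !mxE -val_eqE /= /bump leqNgt ltn_ord add0n.
by rewrite ltn_eqF //= add1n eqSS eq_sym -val_eqE.
Qed.

End Companion.

(** By Cayley-Hamilton; consequently the first n + 1 terms v B^j w decide whether a given integer
    divides all of them. *)
Lemma CayleyHamilton_recur (n : nat) (B : 'M[int]_n.+1) (v : 'rV_n.+1)
    (w : 'cV_n.+1) :
  recur (fun i : 'I_n.+1 => - (char_poly B)`_i)
    (fun j => (v *m B ^+ j *m w) ord0 0).
Proof.
move=> m.
have CH : B ^+ n.+1 = \sum_(i < n.+1) - (char_poly B)`_i *: B ^+ i.
  have := Cayley_Hamilton B; rewrite -{1}(coefK (char_poly B)) poly_def.
  rewrite size_char_poly raddf_sum big_ord_recr /=.
  have /monicP := char_poly_monic B; rewrite /lead_coef size_char_poly => ->.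
  rewrite scale1r rmorphXn /= horner_mx_X => /eqP.
  rewrite addrC addr_eq0 => /eqP ->.
  rewrite -sumrN; apply: eq_bigr => i _.
  by rewrite scaleNr linearZ /= rmorphXn /= horner_mx_X.
rewrite exprD CH mulr_sumr mulmx_sumr mulmx_suml summxE.
apply: eq_bigr => i _.
by rewrite -scalerAr -scalemxAr -scalemxAl mxE exprD.
Qed.

Lemma recur_dvdz (n : nat) (c : 'I_n -> int) (y : nat -> int) (q : int) :
  recur c y -> (forall l, (l < n)%N -> (q %| y l)%Z) -> forall m, (q %| y m)%Z.
Proof.
move=> y_rec q_y m; elim/ltn_ind: m => m IH; case: (ltnP m n) => mn.
  exact: q_y.
rewrite -(subnK mn) y_rec; apply: rpred_sum => i _; apply: dvdz_mull.
by apply: IH; rewrite -[X in (_ < X)%N](subnK mn) ltn_add2l.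
Qed.

Lemma exists_expr_eq1 (A : finComUnitRingType) (n : nat) (M : 'M[A]_n.+1) :
  M \is a GRing.unit -> exists2 m, (0 < m)%N & M ^+ m = 1.
Proof.
move=> Mu; pose u : {unit 'M[A]_n.+1} := FinRing.unit 'M[A]_n.+1 Mu.
exists #[u]%g; first exact: order_gt0.
by rewrite -[M]/(val u) -FinRing.val_unitX expg_order.
Qed.

(** Modulo p the matrix is invertible over a finite field, hence of finite order. The binomial
    expansion of (1 + pB)^h then has the shape treated by [strassmann]. *)
Lemma expM_mod_prime (k p : nat) (M : 'M[int]_k.+1) :
    prime p -> coprime p `|\det M| ->
  exists m, (0 < m)%N /\ exists B : 'M[int]_k.+1, M ^+ m = 1 + p%:R *: B.
Proof.
move=> p_pr pM; have pchar_p := pchar_Fp p_pr.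
pose f := intr : int -> 'F_p.
have Fdvd z : (p %| z)%Z = (z%:~R == 0 :> 'F_p) by rewrite (dvdz_pcharf
  pchar_p).
have : map_mx f M \is a GRing.unit.
  rewrite -[_ \is a _]/(_ \in unitmx) unitmxE det_map_mx unitfE /f -Fdvd.
  by rewrite dvdzE /= -prime_coprime.
case/exists_expr_eq1 => m m_gt0 Mm; exists m; split=> //.
exists (map_mx (fun z => (z %/ p)%Z) (M ^+ m - 1)).
apply/matrixP => i j; rewrite !mxE.
have : (p %| (M ^+ m - 1)%R i j)%Z.
  rewrite Fdvd -/(f _).
  have : map_mx f (M ^+ m - 1) = 0.
    by rewrite rmorphB rmorphXn Mm rmorph1 subrr.
  by move/matrixP/(_ i j); rewrite !mxE => ->.
by move/divzK => e; rewrite !mxE in e *; rewrite [p%:R]natz [p%:Z * _]mulrC e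
  addrC subrK.
Qed.

(** * Uniform zero estimate *)

Lemma count_modn_sum (m : nat) (s : seq nat) : (0 < m)%N ->
  size s = (\sum_(b < m) count (fun h => h %% m == b) s)%N.
Proof.
move=> m_gt0; elim: s => [|h s IH] /=; first by rewrite big1.
rewrite big_split /= -IH (bigD1 (Ordinal (ltn_pmod h m_gt0))) //= eqxx.
by rewrite big1 ?addn0 // => i /negbTE; rewrite -val_eqE /= eq_sym => ->.
Qed.

(** With C the companion matrix and C^m = 1 + pB for one large prime p, the solution on each class b
    modulo m is the sum of C(h, j) p^j w_j, where w_j = v B^j phi. Strassmann's theorem leaves at
    most k zeros per class. Neither p nor m depends on phi, which makes the bound uniform. *)
Lemma zero_bound (F : numFieldType) (k : nat) (c : 'I_k.+1 -> int)
    (z : 'I_k.+1 -> F) :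
    c ord0 != 0 -> (forall j, z j != 0) ->
    (forall m, (0 < m)%N -> injective (fun j => z j ^+ m)) ->
    (forall j, z j ^+ k.+1 = \sum_i (c i)%:~R * z j ^+ i) ->
  exists Z : nat, forall phi : 'cV[int]_k.+1, phi != 0 ->
    forall hs : seq nat, uniq hs ->
      (forall h, h \in hs -> (compan c ^+ h *m phi) ord0 0 = 0) ->
    (size hs <= Z)%N.
Proof.
move=> c0 z0 z_nondeg z_root.
have [p p_big p_pr] := prime_above (maxn k.+2 `|c ord0|).
have kp : (k.+2 < p)%N by apply: leq_ltn_trans p_big; rewrite leq_maxl.
have c0p : (`|c ord0| < p)%N by apply: leq_ltn_trans p_big; rewrite leq_maxr.
have pdet : coprime p `|\det (compan c)|.
  rewrite absz_det_compan prime_coprime //; apply: contraTN c0p => pc0.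
  by rewrite -leqNgt dvdn_leq // absz_gt0.
have [m [m_gt0 [B CmB]]] := expM_mod_prime p_pr pdet.
exists (m * k.+1)%N => phi phi0 hs hs_uniq hs0.
rewrite (count_modn_sum hs m_gt0).
have -> : (m * k.+1 = \sum_(b < m) k.+1)%N by rewrite sum_nat_const card_ord.
apply: leq_sum => b _.
pose y h := (compan c ^+ h *m phi) ord0 0.
pose v : 'rV[int]_k.+1 := row ord0 (compan c ^+ b).
pose w j := (v *m B ^+ j *m phi) ord0 0.
have w_rec : recur _ w := CayleyHamilton_recur B v phi.
have yw h : y (b + m * h)%N = \sum_(j < h.+1) 'C(h, j)%:R * p%:R ^+ j * w j.
  rewrite /y exprD exprM CmB addrC exprD1n mulr_sumr mulmx_suml summxE.
  apply: eq_bigr => j _.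
  rewrite mulrnAr exprZn -scalerAr -scaler_nat -!scalemxAl.
  rewrite [LHS]mxE [X in _ * X]mxE mulrA.
  by congr (_ * _); rewrite /w /v -row_mul -row_mul [RHS]mxE.
(* If w_0, ..., w_k vanish, so do all w_j, and the solution is zero on the whole class. As the z_j^m
   are distinct by non-degeneracy, all its Binet coefficients vanish, against phi != 0. *)
have [l lk wl] : exists2 l, (l < k.+1)%N & w l != 0.
  case: (boolP [exists l : 'I_k.+1, w l != 0]) => [/existsP[l wl]|].
    by exists l.
  move=> /existsPn w0; case/eqP: phi0.
  have w_0 j : w j = 0.
    apply/eqP; rewrite -dvd0z; apply: recur_dvdz w_rec _ _ => l lk.
    by rewrite dvd0z; have := w0 (Ordinal lk); rewrite negbK.
  have y0 h : y (b + m * h)%N = 0.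
    by rewrite yw big1 // => j _; rewrite w_0 mulr0.
  have [||A yA] := @binet F k.+1 (fun i => (c i)%:~R) z (fun h =>
    (y h)%:~R) _ z_root.
  - by move=> i j zij; apply: (z_nondeg 1%N) => //; rewrite !expr1.
  - move=> h; rewrite [y _](recur_compan c phi) rmorph_sum.
    by apply: eq_bigr => i _; rewrite rmorphM.
  have A0 : forall j, A j * z j ^+ b = 0.
    apply: (exp_indep (z_nondeg _ m_gt0)) => h _.
    have := yA (b + m * h)%N; rewrite y0 => /esym; rewrite mulr0z => e.
    by rewrite -[RHS]e; apply: eq_bigr => j _; rewrite exprD exprM mulrA.
  rewrite -(state_compan c phi); apply/matrixP => i j;
    rewrite mxE [RHS]mxE add0n.
  apply/eqP; rewrite -(intr_eq0 F) -/(y i) yA big1 // => j' _.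
  by have /eqP := A0 j'; rewrite mulf_eq0 expf_eq0 (negbTE (z0 _)) andbF orbF
    => /eqP ->; rewrite mul0r.
(* The largest power of p dividing all w_j is divided out, so that one of the first k + 1 becomes
   prime to p. The nonzero w_l bounds the exponent. *)
pose P e := [forall l : 'I_k.+1, (p%:Z ^+ e %| w l)%Z].
have exP : exists e, P e by exists 0%N; apply/forallP => l';
  rewrite expr0 dvd1z.
have ubP e : P e -> (e <= `|w l|)%N.
  move/forallP/(_ (Ordinal lk)); rewrite /= dvdzE abszX => /dvdn_leq.
  rewrite absz_gt0 wl => /(_ isT) /=; apply: leq_trans.
  by apply/ltnW/ltn_expl; apply: prime_gt1.
case: (ex_maxnP exP ubP) => e Pe e_max.
have pe0 : p%:Z ^+ e != 0 by rewrite expf_neq0 //; have := prime_gt0 p_pr; lia.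
have w_dvd j : (p%:Z ^+ e %| w j)%Z.
  apply: recur_dvdz w_rec _ _ => l' lk'; exact: (forallP Pe (Ordinal lk')).
pose hs' := [seq (h %/ m)%N | h <- hs & (h %% m == b)%N].
have -> : count (fun h => h %% m == b)%N hs = size hs'.
  by rewrite size_map size_filter.
apply: ltnW; apply: (@strassmann p k.+1 (fun j => (w j %/ p%:Z ^+ e)%Z)) => //.
- have : ~~ P e.+1 by apply/negP => /e_max; rewrite ltnn.
  rewrite negb_forall => /existsP[l' pl']; exists l' => //.
  apply: contra pl' => pl'.
  by rewrite -(divzK (w_dvd l')) exprS dvdz_mul2r.
- rewrite map_inj_in_uniq ?filter_uniq // => h1 h2.
  rewrite !mem_filter => /andP[/eqP h1b _] /andP[/eqP h2b _] e12.
  by rewrite (divn_eq h1 m) (divn_eq h2 m) h1b h2b e12.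
- move=> h /mapP[h1]; rewrite mem_filter => /andP[/eqP h1b h1hs] eh.
  apply: (mulIf pe0); rewrite mul0r mulr_suml.
  have := hs0 _ h1hs; rewrite (divn_eq h1 m) h1b -eh addnC mulnC -/(y _) yw.
  by apply: etrans; apply: eq_bigr => j _; rewrite -[LHS]mulrA divzK.
Qed.

(** * Integers with few common factors *)

Section NatFacts.

Local Open Scope nat_scope.

Lemma dvdn_logn (m n : nat) : 0 < m -> 0 < n ->
  (forall p, prime p -> logn p m <= logn p n) -> m %| n.
Proof.
move=> m_gt0 n_gt0 le_mn; apply/dvdn_partP => // p.
rewrite mem_primes => /andP[p_pr _].
by rewrite p_part pfactor_dvdn // le_mn.
Qed.

Lemma logn_prodn (I : finType) (P : pred I) (f : I -> nat) (p : nat) :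
  (forall i, P i -> 0 < f i) ->
  logn p (\prod_(i | P i) f i) = \sum_(i | P i) logn p (f i).
Proof.
move=> f_gt0.
suff [] : 0 < \prod_(i | P i) f i /\
  logn p (\prod_(i | P i) f i) = \sum_(i | P i) logn p (f i) by [].
apply: (big_rec2 (fun x y => 0 < x /\ logn p x = y)).
  by rewrite logn1.
move=> i x y Pi [x_gt0 <-]; rewrite muln_gt0 f_gt0 //; split=> //.
by rewrite lognM // f_gt0.
Qed.

(** Greedy choice: each chosen vertex discards itself and at most t neighbours. *)
Lemma exists_independent_set (T : finType) (e : rel T) (t : nat) :
    symmetric e -> (forall i, #|[set j | e i j]| <= t) ->
    forall (n : nat) (V : {set T}), n * t.+1 <= #|V| ->
  exists I : {set T}, [/\ I \subset V, #|I| = n &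
    {in I &, forall i j, i != j -> ~~ e i j}].
Proof.
move=> e_sym e_deg; elim=> [|n IH] V nV.
  exists finset.set0; split; rewrite ?finset.sub0set ?cards0 // => i j;
    by rewrite inE.
have [i iV] : exists i, i \in V.
  by apply/finset.set0Pn; rewrite -card_gt0; apply: leq_trans nV; rewrite mulSn.
pose V' := V :\: (i |: [set j | e i j]).
have cV' : n * t.+1 <= #|V'|.
  rewrite cardsD; have : #|V :&: (i |: [set j | e i j])| <= t.+1.
    apply: leq_trans (subset_leq_card (finset.subsetIr _ _)) _.
    by rewrite cardsU1; apply: (leq_add (leq_b1 _)).
  by move: nV; rewrite mulSn; lia.
have [I [IV' cI I_ind]] := IH _ cV'.
have iI j : j \in I -> [/\ j \in V, j != i & ~~ e i j].
  by move/(fintype.subsetP IV'); rewrite !inE negb_or => /andP[/andP[]].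
exists (i |: I); split.
- by rewrite finset.subUset finset.sub1set iV; apply/fintype.subsetP => j /iI[].
- rewrite cardsU1 cI; case: (boolP (i \in I)) => // /iI[_].
  by rewrite eqxx.
- move=> j l; rewrite !inE => /orP[/eqP->|jI] /orP[/eqP->|lI].
  + by rewrite eqxx.
  + by case: (iI _ lI).
  + by rewrite e_sym; case: (iI _ jI).
  + exact: I_ind.
Qed.

End NatFacts.

Section GcdGraph.

Local Open Scope nat_scope.

Variables (T : finType) (a : T -> nat) (D Z : nat).
Hypothesis a_gt0 : forall i, 0 < a i.
Hypothesis D_gt0 : 0 < D.
Hypothesis few_large : forall p, prime p ->
  #|[set i | logn p D < logn p (a i)]| <= Z.

(** Compare valuations at each prime p: the gcd with a_j contributes at most v_p(D), except for at
    most Z indices j, where it contributes at most v_p(a_i). *)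
Lemma prod_gcd_dvdn (i : T) (N : {set T}) :
  \prod_(j in N) gcdn (a i) (a j) %| a i ^ Z * D ^ #|N|.
Proof.
apply: dvdn_logn.
- by apply: prodn_gt0 => j; rewrite gcdn_gt0 a_gt0.
- by rewrite muln_gt0 !expn_gt0 a_gt0 D_gt0.
move=> p p_pr; rewrite logn_prodn => [|j _]; last by rewrite gcdn_gt0 a_gt0.
rewrite lognM ?expn_gt0 ?a_gt0 ?D_gt0 // !lognX.
pose L := [set j | logn p D < logn p (a j)].
apply: (@leq_trans (\sum_(j in N) (logn p D + logn p (a i) * (j \in L)))).
  apply: leq_sum => j _; rewrite logn_gcd ?a_gt0 // inE.
  by case: ltnP => ?; rewrite ?muln1 ?muln0 ?addn0; lia.
rewrite big_split /= sum_nat_const addnC leq_add //.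
rewrite -big_distrr /= mulnC leq_mul2r; apply/orP; right.
apply: leq_trans (few_large p_pr); rewrite -/L -sum1_card.
rewrite big_mkcond [X in _ <= X]big_mkcond; apply: leq_sum => j _ /=.
by case: ifP; case: (_ \in L).
Qed.

(** Join i and j when gcd(a_i, a_j)^r >= X. For a set N of neighbours of i, X^|N| <= (a_i^Z
    D^|N|)^r; after squaring, the powers of D cost only X^|N|, whence |N| <= 2qZr. In an independent
    set of r + 1 indices, the product of the r gcds with a_i is less than X <= a_i. *)
Lemma exists_small_gcds (F : realFieldType) (X : F) (r q : nat) :
    (1 < X)%R ->
    (forall i, (X <= (a i)%:R)%R) -> (forall i, ((a i)%:R <= X ^+ q)%R) ->
    (D%:R ^+ (2 * r) <= X)%R ->
    r.+1 * (2 * (q * Z * r)).+1 <= #|T| ->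
  exists I : {set T}, #|I| = r.+1 /\
    forall i, i \in I -> \prod_(j in I :\ i) gcdn (a i) (a j) < a i.
Proof.
move=> X_gt1 X_le le_X D_X cT.
have X_gt0 : (0 < X)%R by apply: lt_trans X_gt1.
have X_ge0 := ltW X_gt0.
pose e i j := (i != j) && (X <= (gcdn (a i) (a j))%:R ^+ r)%R.
have e_sym : symmetric e by move=> i j; rewrite /e eq_sym gcdnC.
have e_deg i : #|[set j | e i j]| <= 2 * (q * Z * r).
  set N := [set j | e i j].
  have XN : (X ^+ #|N| <= ((a i) ^ Z * D ^ #|N|)%:R ^+ r)%R.
    apply: (@le_trans _ _ ((\prod_(j in N) gcdn (a i) (a j))%:R ^+ r)%R).
      rewrite natr_prod -prodrXl -prodr_const; apply: ler_prod => j.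
      by rewrite inE => /andP[_ ->]; rewrite X_ge0.
    rewrite lerXn2r ?nnegrE ?ler0n // ler_nat dvdn_leq ?prod_gcd_dvdn //.
    by rewrite muln_gt0 !expn_gt0 a_gt0 D_gt0.
  have : (X ^+ (2 * #|N|) <= X ^+ (2 * (q * Z * r) + #|N|))%R.
    rewrite mulnC exprM; apply: (@le_trans _ _ ((((a i) ^ Z * D ^ #|N|)%:R ^+
      r) ^+ 2)%R).
      by rewrite lerXn2r ?nnegrE ?exprn_ge0 ?ler0n.
    rewrite natrM !natrX -exprM exprMn exprD; apply: ler_pM;
      rewrite ?exprn_ge0 ?ler0n //.
      rewrite -exprM (_ : 2 * _ = q * (Z * (r * 2))); last by lia.
      by rewrite [leRHS]exprM lerXn2r ?nnegrE ?ler0n ?exprn_ge0.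
    rewrite -exprM (_ : _ * (r * 2) = 2 * r * #|N|); last by lia.
    by rewrite [leLHS]exprM lerXn2r ?nnegrE ?exprn_ge0 ?ler0n.
  by rewrite ler_eXn2l //; lia.
have [I [_ cI I_ind]] := exists_independent_set e_sym e_deg (n := r.+1) (V :=
  finset.setT) ltac:(by rewrite cardsT).
exists I; split=> // i iI.
have c1 : #|I :\ i| = r by have := cardsD1 i I; rewrite iI cI; lia.
have [r0|r_gt0] := posnP r.
  have -> : I :\ i = finset.set0 by apply/eqP; rewrite -cards_eq0 c1 r0.
  by rewrite big_set0 -(ltr_nat F); apply: lt_le_trans (X_le i).
rewrite -(ltr_nat F) -(ltr_pXn2r r_gt0) ?nnegrE ?ler0n //.
apply: (@lt_le_trans _ _ (X ^+ r)%R); last by rewrite lerXn2r ?nnegrE ?ler0n.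
rewrite natr_prod -prodrXl -{2}c1 -prodr_const.
have [j0 j0I] : exists j, j \in I :\ i.
  by apply/finset.set0Pn; rewrite -card_gt0 c1.
apply: ltr_prod; first by apply/hasP; exists j0; rewrite ?mem_index_enum.
move=> j; rewrite !inE => /andP[ji jI].
rewrite exprn_ge0 ?ler0n //=.
have := I_ind _ _ iI jI; rewrite eq_sym ji => /(_ isT).
by rewrite /e eq_sym ji /= -ltNge.
Qed.

(** For i with |kap_i| maximal, the relation gives v_p(a_i) <= sum of the other v_p(a_j) for every
    p. Hence a_i divides the product of its gcds with the others, which is too small. *)
Lemma small_gcds_free (I : {set T}) :
    (forall i, i \in I -> \prod_(j in I :\ i) gcdn (a i) (a j) < a i) ->
  forall kap : T -> rat,
    (forall p, prime p -> (\sum_(i in I) kap i * (logn p (a i))%:R = 0)%R) ->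
  forall i, i \in I -> kap i = 0%R.
Proof.
move=> I_gcd kap kap0 i0 i0I; apply/eqP/negPn/negP => kap_i0.
have [i iI i_max'] := @Order.TotalTheory.arg_maxP _ _ T i0 (mem I) (fun i =>
  `|kap i|)%R i0I.
have i_max j : j \in I -> (`|kap j| <= `|kap i|)%R by move/i_max'.
have kap_i : (0 < `|kap i|)%R.
  by apply: lt_le_trans (i_max _ i0I); rewrite normr_gt0.
have := I_gcd _ iI; rewrite ltnNge => /negP; apply.
apply: dvdn_leq; first by apply: prodn_gt0 => j; rewrite gcdn_gt0 a_gt0.
apply: dvdn_logn => //; first by apply: prodn_gt0 => j; rewrite gcdn_gt0 a_gt0.
move=> p p_pr; rewrite logn_prodn => [|j _]; last by rewrite gcdn_gt0 a_gt0.
under eq_bigr do rewrite logn_gcd //.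
have le_v : logn p (a i) <= \sum_(j in I :\ i) logn p (a j).
  rewrite -(ler_nat rat) -(ler_pM2l kap_i) natr_sum mulr_sumr.
  have := kap0 _ p_pr; rewrite (big_setD1 i) //= => /eqP.
  rewrite addr_eq0 => /eqP /(congr1 Num.norm).
  rewrite normrM normrN (ger0_norm (ler0n _ _)) => ->.
  apply: le_trans (ler_norm_sum _ _ _) _; apply: ler_sum => j.
  rewrite !inE => /andP[_ jI]; rewrite normrM (ger0_norm (ler0n _ _)).
  by rewrite ler_wpM2r ?ler0n // i_max.
(* Either one minimum already equals v_p(a_i), or every minimum is v_p(a_j) and [le_v] applies. *)
have [/existsP[j /andP[jI ij]]|] := boolP [exists j, (j \in I :\ i) && (logn p
  (a i) <= logn p (a j))].
  by rewrite (bigD1 j) //= (minn_idPl ij) leq_addr.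
move=> /existsPn small; rewrite [leqRHS](eq_bigr (fun j => logn p (a j))) // =>
  j jI.
by have := small j; rewrite jI /= -ltnNge => /ltnW /minn_idPr.
Qed.

(** Otherwise there are r + 1 indices with small gcds; their r + 1 exponent vectors in dimension r
    are linearly dependent, and the dependency contradicts [small_gcds_free]. *)
Lemma card_low_rank (F : realFieldType) (X : F) (r q : nat)
    (E : T -> 'I_r -> rat) (w : nat -> 'I_r -> rat) :
    (1 < X)%R ->
    (forall i, (X <= (a i)%:R)%R) -> (forall i, ((a i)%:R <= X ^+ q)%R) ->
    (D%:R ^+ (2 * r) <= X)%R ->
    (forall i p, prime p -> ((logn p (a i))%:R = \sum_l E i l * w p l)%R) ->
  #|T| < r.+1 * (2 * (q * Z * r)).+1.
Proof.
move=> X_gt1 X_le le_X D_X Ew; rewrite ltnNge; apply/negP => cT.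
have [I [cI I_gcd]] := exists_small_gcds X_gt1 X_le le_X D_X cT.
pose M : 'M[rat]_(#|I|, r) := (\matrix_(i, l) E (enum_val i) l)%R.
have kerM : kermx M != 0%R.
  by rewrite kermx_eq0 /row_free neq_ltn (leq_ltn_trans (rank_leq_col M)) // cI.
have [v vM v0] := rowV0Pn kerM.
move/sub_kermxP: vM => vM.
have [i0 i0I] : exists i, i \in I by apply/finset.set0Pn; rewrite -card_gt0 cI.
pose kap i : rat := v ord0 (enum_rank_in i0I i).
have kap_enum l : kap (enum_val l) = v ord0 l by rewrite /kap enum_valK_in.
case/eqP: v0; apply/rowP => l; rewrite mxE -kap_enum.
apply: (small_gcds_free I_gcd); last exact: enum_valP.
move=> p p_pr; rewrite big_enum_val /=.
under eq_bigr do rewrite kap_enum Ew // mulr_sumr.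
rewrite exchange_big big1 //= => j _.
have /rowP/(_ j) := vM; rewrite !mxE => vMj.
under eq_bigr do rewrite mulrA.
rewrite -mulr_suml (_ : (\sum_i _ = 0)%R) ?mul0r //.
by apply: etrans vMj; apply: eq_bigr => i _; rewrite mxE.
Qed.

End GcdGraph.

(** * Minors of the companion orbit *)

Lemma norm_det_le (n : nat) (M : 'M[int]_n) (B : int) :
  (forall i j, `|M i j| <= B) -> `|\det M| <= (n`!)%:R * B ^+ n.
Proof.
move=> MB; apply: le_trans (ler_norm_sum _ _ _) _.
have -> : (n`!)%:R * B ^+ n = \sum_(s : 'S_n) B ^+ n.
  by rewrite sumr_const card_Sn mulr_natl.
apply: ler_sum => s _; rewrite normrM normrX normrN1 expr1n mul1r normr_prod.
have -> : B ^+ n = \prod_(i < n) B by rewrite prodr_const card_ord.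
by apply: ler_prod => i _; rewrite normr_ge0 MB.
Qed.

Lemma norm_mxX_le (n : nat) (M : 'M[int]_n.+1) (B : int) :
  1 <= B -> (forall i j, `|M i j| <= B) ->
  forall h i j, `|(M ^+ h) i j| <= (n.+1%:R * B) ^+ h.
Proof.
move=> B1 MB; elim=> [|h IH] i j.
  by rewrite !expr0 mxE; case: (_ == _).
rewrite exprS mxE; apply: le_trans (ler_norm_sum _ _ _) _.
have -> : (n.+1%:R * B) ^+ h.+1 = \sum_(l < n.+1) B * (n.+1%:R * B) ^+ h.
  by rewrite sumr_const card_ord exprS -mulrA mulr_natl.
by apply: ler_sum => l _; rewrite normrM ler_pM ?normr_ge0.
Qed.

Lemma exists_int_kernel (m n : nat) (M : 'M[int]_(m, n)) :
  ~~ row_full (map_mx intr M : 'M[rat]_(m, n)) ->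
  exists2 phi : 'cV[int]_n, phi != 0 & M *m phi = 0.
Proof.
rewrite /row_full -mxrank_tr -[_ == _]/(row_free _) -kermx_eq0.
case/rowV0Pn => v /sub_kermxP vM v0.
(* The kernel vector is read as a polynomial so that [rat_poly_scale] clears its denominators. *)
have [q [a a0 qv]] := rat_poly_scale (rVpoly v).
have aQ : (a%:~R : rat)^-1 != 0 by rewrite invr_eq0 intr_eq0.
have vq i : v ord0 i = a%:~R^-1 * (q`_i)%:~R.
  by rewrite -[LHS]coef_rVpoly_ord qv coefZ coef_map.
exists (\col_i q`_i).
  apply: contra v0 => /eqP q0; apply/eqP/rowP => i; rewrite vq mxE.
  by have /colP/(_ i) := q0; rewrite !mxE => ->; rewrite mulr0.
apply/colP => i; rewrite !mxE; apply/eqP; rewrite -(intr_eq0 rat).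
have /rowP/(_ i) := vM; rewrite !mxE.
under eq_bigr do rewrite vq !mxE -mulrA.
rewrite -mulr_sumr => /eqP; rewrite mulf_eq0 (negbTE aQ) /=.
move=> /eqP e; apply/eqP; rewrite -[RHS]e rmorph_sum; apply: eq_bigr => j _.
by rewrite mxE rmorphM mulrC.
Qed.

Section Discriminant.

Variables (k : nat) (c : 'I_k.+1 -> int) (T : finType) (h : T -> nat).

Definition orbit_mx (f : 'I_k.+1 -> T) : 'M[int]_k.+1 :=
  \matrix_(i, j) (compan c ^+ h (f i)) ord0 j.

(** Replacing zero minors by 1 yields a positive integer divisible by every nonzero minor; it serves
    as D in the gcd estimates. *)
Definition minors_prod : nat :=
  (\prod_(f : {ffun 'I_k.+1 -> T})
     if \det (orbit_mx f) == 0 then 1 else `|\det (orbit_mx f)|)%N.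

Lemma minors_prod_gt0 : (0 < minors_prod)%N.
Proof.
by apply: prodn_gt0 => f; case: eqP => // /eqP; rewrite absz_gt0.
Qed.

(** If S had more than Z elements, the zero estimate would give its rows full column rank, hence a
    nonzero minor. Multiplying by the adjugate, p^e divides this minor times a coordinate of v prime
    to p, so it divides the minor; but e exceeds v_p of [minors_prod]. *)
Lemma few_large_valuations (Z : nat) (p : nat) (v : 'cV[int]_k.+1) :
    (forall phi : 'cV[int]_k.+1, phi != 0 -> forall hs : seq nat, uniq hs ->
      (forall m, m \in hs -> (compan c ^+ m *m phi) ord0 0 = 0) ->
      (size hs <= Z)%N) ->
    injective h -> prime p -> (exists j, ~~ (p %| v j ord0)%Z) ->
  (#|[set i | (p%:Z ^+ (logn p minors_prod).+1 %|
       ((compan c ^+ h i *m v) ord0 ord0))%Z]| <= Z)%N.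
Proof.
move=> Zbound h_inj p_pr [j0 pvj0]; set e := (logn p minors_prod).+1; set S :=
  [set i | _].
rewrite leqNgt; apply/negP => ZS.
pose M : 'M[int]_(#|S|, k.+1) :=
  \matrix_(i, j) (compan c ^+ h (enum_val i)) ord0 j.
have Mphi (phi : 'cV_k.+1) i : (M *m phi) i 0 = (compan c ^+ h (enum_val i) *m
  phi) ord0 0.
  by rewrite !mxE; apply: eq_bigr => j _; rewrite mxE.
have [Mfull|/exists_int_kernel[phi phi0 Mphi0]] :=
    boolP (row_full (map_mx intr M : 'M[rat]_(_, _))); last first.
  suff : (size [seq h i | i <- enum S] <= Z)%N.
    by rewrite size_map -cardE leqNgt ZS.
  apply: Zbound phi0 _ _ _; first by rewrite map_inj_uniq ?enum_uniq.
  move=> _ /mapP[i iS ->]; rewrite mem_enum in iS.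
  have := Mphi phi (enum_rank_in iS i); rewrite enum_rankK_in // => <-.
  by rewrite Mphi0 mxE.
pose f := [ffun i => enum_val (fullrankfun Mfull i)].
have fS i : f i \in S by rewrite ffunE enum_valP.
have fM : orbit_mx f = rowsub (fullrankfun Mfull) M.
  by apply/matrixP => i j; rewrite !mxE ffunE.
have det0 : \det (orbit_mx f) != 0.
  rewrite fM -(intr_eq0 rat) -det_map_mx map_mxsub -unitfE -unitmxE.
  exact: fullrowsub_unit.
have : (p%:Z ^+ e %| \det (orbit_mx f))%Z.
  have pfv i : (p%:Z ^+ e %| (orbit_mx f *m v) i ord0)%Z.
    rewrite (_ : _ i ord0 = (compan c ^+ h (f i) *m v) ord0 0).
      by have := fS i; rewrite inE.
    by rewrite !mxE; apply: eq_bigr => j _; rewrite mxE.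
  have : (p%:Z ^+ e %| \det (orbit_mx f) * v j0 ord0)%Z.
    rewrite (_ : _ * _ = (\adj (orbit_mx f) *m (orbit_mx f *m v)) j0 ord0).
      by rewrite mxE; apply: rpred_sum => i _; apply: dvdz_mull.
    by rewrite mulmxA mul_adj_mx mul_scalar_mx mxE.
  rewrite Gauss_dvdzl // coprimezE abszX coprimeXl //.
  by rewrite prime_coprime.
rewrite dvdzE abszX pfactor_dvdn ?absz_gt0 //= leqNgt => /negP; apply.
rewrite ltnS dvdn_leq_log ?minors_prod_gt0 //.
rewrite /minors_prod (bigD1 f) //= (negbTE det0); exact: dvdn_mulr.
Qed.

(** For a fixed index set T the bound is exp(O(N)): only the exponent of the entry bound depends on
    N, and linearly. *)
Lemma minors_prod_le (B : nat) (N : nat) :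
    (0 < B)%N -> (forall i, (`|c i| <= B)%N) -> (forall i, (h i <= N)%N) ->
  (minors_prod <= (k.+1`! * (k.+1 * B) ^ (N * k.+1)) ^ (#|T| ^ k.+1))%N.
Proof.
move=> B_gt0 cB hN.
have -> : (#|T| ^ k.+1 = #|{ffun 'I_k.+1 -> T}|)%N by rewrite card_ffun
  card_ord.
rewrite -prod_nat_const; apply: leq_prod => f _.
have b1 : (0 < k.+1`! * (k.+1 * B) ^ (N * k.+1))%N.
  by rewrite muln_gt0 fact_gt0 expn_gt0 muln_gt0 B_gt0.
case: ifP => // _.
rewrite -lez_nat abszE PoszM -!natz natrX exprM.
apply: norm_det_le => i j; rewrite mxE.
have CB i' j' : `|compan c i' j'| <= B%:Z.
  rewrite mxE; case: ifP => _; first by rewrite -abszE lez_nat.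
  by case: eqP => _; rewrite ?normr1 ?normr0 ?lez_nat.
apply: le_trans (norm_mxX_le _ CB _ _ _) _; first by rewrite lez_nat.
rewrite natrM !natz; apply: ler_weXn2l (hN _).
by rewrite -PoszM lez_nat muln_gt0.
Qed.

End Discriminant.

(** * Hankel determinants *)

Section Hankel.

Variables (k : nat) (c : 'I_k.+1 -> int) (y : nat -> int).
Hypothesis y_rec : recur c y.

Local Notation stateQ m := (map_mx (intr : int -> rat) (state k y m)).
Local Notation companQ := (map_mx (intr : int -> rat) (compan c)).

Lemma companQX_state m j : companQ ^+ j *m stateQ m = stateQ (m + j).
Proof. by rewrite -rmorphXn -map_mxM companX_state. Qed.

Lemma horner_compan_state (p : {poly rat}) (m : nat) i :
  (horner_mx companQ p *m stateQ m) i 0 =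
  \sum_(j < size p) p`_j * (y (m + j + i)%N)%:~R.
Proof.
rewrite -{1}(coefK p) poly_def raddf_sum mulmx_suml summxE.
apply: eq_bigr => j _ /=.
rewrite horner_mxZ rmorphXn /= horner_mx_X -scalemxAl companQX_state.
by rewrite !mxE.
Qed.

(** A polynomial in the companion matrix commutes with its powers, so killing the initial state
    means killing every state. *)
Lemma annihilator_shift (p : {poly rat}) :
  horner_mx companQ p *m stateQ 0 = 0 ->
  forall m, \sum_(j < size p) p`_j * (y (m + j)%N)%:~R = 0.
Proof.
move=> p0 m.
have := horner_compan_state p m ord0; rewrite -[m in stateQ m]add0n
  -companQX_state.
have comm_p : horner_mx companQ p *m companQ ^+ m = companQ ^+ m *m horner_mx
  companQ p.
  by apply: (@commrX _ (horner_mx companQ p)); apply: comm_horner_mx; apply: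
    comm_mx_refl.
rewrite mulmxA comm_p -mulmxA p0 mulmx0 mxE => /esym.
by under eq_bigr do rewrite addn0.
Qed.

Definition hankel m : 'M[int]_k.+1 := \matrix_(i, j) y (m + i + j)%N.

(** A shift multiplies the Hankel matrix by the companion matrix, of determinant c_0 up to sign. *)
Lemma absz_det_hankel m :
  `|\det (hankel m)|%N = (`|c ord0| ^ m * `|\det (hankel 0)|)%N.
Proof.
elim: m => [|m IH]; first by rewrite mul1n.
have -> : hankel m.+1 = compan c *m hankel m.
  apply/matrixP => i j.
  have := compan_state (m + j)%N y_rec => /matrixP/(_ i ord0).
  rewrite !mxE => e; rewrite -addnA (addnC i) addnA !addSn -addSn.
  rewrite addSn -e; apply: eq_bigr => l _.
  by rewrite !mxE addnAC.
by rewrite det_mulmx abszM absz_det_compan IH expnS mulnA.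
Qed.

Definition window_gcd m : nat := \big[gcdn/0%N]_(i < k.+1) `|y (m + i)%N|%N.

Lemma window_gcd_dvd m h : ((window_gcd m)%:Z %| y (m + h)%N)%Z.
Proof.
have sub : recur c (fun h => y (m + h)%N).
  by move=> l; rewrite addnA y_rec; apply: eq_bigr => i _; rewrite addnA.
apply: (recur_dvdz sub) => l lk; rewrite dvdzE /=.
exact: (biggcdn_inf (Ordinal lk)).
Qed.

Lemma window_gcd_exp_dvd m :
  (window_gcd m ^ k.+1 %| `|\det (hankel m)|)%N.
Proof.
pose H' : 'M[int]_k.+1 := \matrix_(i, j) (y (m + i + j)%N %/ (window_gcd
  m)%:Z)%Z.
have -> : hankel m = (window_gcd m)%:Z *: H'.
  by apply/matrixP => i j; rewrite !mxE mulrC divzK // -addnA window_gcd_dvd.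
by rewrite detZ abszM abszX dvdn_mulr.
Qed.

Lemma window_gcd_primitive m (p : nat) : (0 < window_gcd m)%N -> prime p ->
  exists i : 'I_k.+1, ~~ (p %| (y (m + i)%N %/ (window_gcd m)%:Z))%Z.
Proof.
move=> g_gt0 p_pr; apply/existsP; rewrite -negb_forall; apply/negP =>
  /forallP pg.
have : (p * window_gcd m %| window_gcd m)%N.
  rewrite {2}/window_gcd; apply/dvdn_biggcdP => i _.
  have := pg i; rewrite -(@dvdz_mul2r (window_gcd m)%:Z); last by lia.
  by rewrite divzK ?window_gcd_dvd // dvdzE abszM.
by move/dvdn_leq => /(_ g_gt0); have := prime_gt1 p_pr; nia.
Qed.

Hypothesis k_gt0 : (0 < k)%N.
Hypothesis y_min : forall (e : nat) (c' : 'I_e -> int),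
  (0 < e)%N -> (e < k.+1)%N -> ~ recur c' y.

(* A vanishing determinant yields a rational annihilator of degree at most k.
   Its gcd with the characteristic polynomial, made primitive, divides a monic
   integer polynomial, hence is monic up to sign (Gauss) and gives a shorter
   integer recurrence. *)
Lemma det_hankel_neq0 : \det (hankel 0) != 0.
Proof.
apply/negP => /eqP det0.
have : \det (map_mx (intr : int -> rat) (hankel 0)) == 0.
  by rewrite det_map_mx det0.
case/det0P => v v0 vH.
pose p := rVpoly v.
have p0 : p != 0.
  by apply: contra v0 => /eqP p0; rewrite -(rVpolyK v) -/p p0 linear0.
have size_p : (size p <= k.+1)%N by apply: size_poly.
have p_ann : horner_mx companQ p *m stateQ 0 = 0.
  apply/colP => i; rewrite horner_compan_state mxE.
  have /rowP/(_ i) := vH; rewrite !mxE; apply: etrans.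
  transitivity (\sum_(j < k.+1) p`_j * (y (j + i)%N)%:~R).
    rewrite [RHS](bigID (fun j : 'I_k.+1 => (j < size p)%N)) /= [X in _ +
      X]big1.
      by rewrite addr0 -(big_ord_widen _ (fun j =>
        p`_j * (y (j + i)%N)%:~R) size_p).
    by move=> j; rewrite -leqNgt => /(nth_default 0) ->; rewrite mul0r.
  by apply: eq_bigr => j _; rewrite coef_rVpoly_ord !mxE.
pose f := char_poly_rec c.
have f_monic : f \is monic := monic_char_poly_rec c.
pose fQ := map_poly (intr : int -> rat) f.
have f_ann : horner_mx companQ fQ *m stateQ 0 = 0.
  rewrite /fQ /f rmorphB rmorph_sum /= map_polyXn rmorphB rmorph_sum rmorphXn
    /=.
  rewrite horner_mx_X mulmxBl companQX_state mulmx_suml; apply/eqP;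
    rewrite subr_eq0.
  apply/eqP/colP => i; rewrite summxE !mxE add0n addnC y_rec rmorph_sum.
  apply: eq_bigr => j _.
  rewrite map_polyZ map_polyXn horner_mxZ rmorphXn /= horner_mx_X.
  by rewrite -scalemxAl companQX_state !mxE rmorphM addnC.
pose g := gcdp p fQ.
have g_ann : horner_mx companQ g *m stateQ 0 = 0.
  have [[ea eb] /eqpf_eq[a a0 /= Bez]] := Bezoutp p fQ.
  apply: (@scalerI _ _ a a0); rewrite scaler0 scalemxAl -horner_mxZ -Bez.
  by rewrite rmorphD !rmorphM mulmxDl -!mulmxA p_ann f_ann !mulmx0 addr0.
have [g1 [a a0 gg1] [r fr]] := dvdpP_rat_int (dvdp_gcdr p fQ : g %| fQ).
have g1_ann : horner_mx companQ (map_poly intr g1) *m stateQ 0 = 0.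
  apply: (@scalerI _ _ a a0); rewrite scaler0.
  by move: g_ann; rewrite gg1 horner_mxZ -scalemxAl.
have size_g1Q : size (map_poly (intr : int -> rat) g1) = size g1.
  by apply: size_map_inj_poly; [exact: intr_inj | ].
have size_g1 : (size g1 <= k.+1)%N.
  apply: leq_trans size_p; rewrite -size_g1Q -(size_scale (map_poly intr g1)
    a0) -gg1.
  by apply: dvdp_leq => //; apply: dvdp_gcdl.
have g1_lead : lead_coef g1 * lead_coef g1 = 1.
  have : lead_coef g1 * lead_coef r = 1 by rewrite -lead_coefM -fr;
    apply/monicP.
  move/(congr1 absz); rewrite abszM => /eqP; rewrite muln_eq1 =>
    /andP[/eqP l1 _].
  by case: (lead_coef g1) l1 => [[|[|n]]|[|n]].
have g1_neq0 : g1 != 0.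
  by rewrite -lead_coef_eq0; apply/eqP => l0; move: g1_lead; rewrite l0 mul0r.
have [e size_e] : exists e, size g1 = e.+1.
  by exists (size g1).-1; rewrite prednK // lt0n size_poly_eq0.
have y_shift m : y (m + e)%N = \sum_(j < e) - (lead_coef g1 * g1`_j) * y (m +
  j)%N.
  have := annihilator_shift g1_ann m; rewrite size_g1Q size_e.
  under eq_bigr do rewrite coef_map /= -rmorphM.
  rewrite -rmorph_sum => /eqP; rewrite intr_eq0 big_ord_recr /=.
  rewrite -[e in g1`_e]/(e.+1.-1) -size_e -lead_coefE addrC addr_eq0 => /eqP.
  move/(congr1 ( *%R (lead_coef g1))); rewrite mulrA g1_lead mul1r => ->.
  by rewrite mulrN mulr_sumr -sumrN; apply: eq_bigr => j _; rewrite mulNr mulrA.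
(* If [g1] is constant, the sequence is zero and satisfies the recurrence of order 1 with
   coefficient 0, which is still shorter since k > 0. *)
case: (posnP e) => [e0|e_gt0].
  apply: (@y_min 1 (fun=> 0)) => // m; rewrite big_ord1 mul0r.
  by have := y_shift (m + 1)%N; rewrite e0 addn0 big_ord0.
by apply: (y_min e_gt0 _ y_shift); rewrite -size_e.
Qed.

End Hankel.

(** * Growth *)

Import complex.
Local Open Scope complex_scope.

Section Growth.

Variable R : realType.

Lemma expr_unbounded (x B : R) : 1 < x ->
  exists m0, forall m, (m0 <= m)%N -> B <= x ^+ m.
Proof.
move=> x1; have bern m : 1 + m%:R * (x - 1) <= x ^+ m.
  elim: m => [|m IH]; first by rewrite mul0r addr0.
  rewrite exprS; apply: (@le_trans _ _ (x * (1 + m%:R * (x - 1)))).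
    rewrite -natr1; have : 0 <= m%:R * (x - 1) * (x - 1).
      by rewrite !mulr_ge0 ?ler0n // subr_ge0 ltW.
    lra.
  by rewrite ler_pM2l // (lt_trans ltr01).
pose b := Num.bound `|B / (x - 1)|; exists b => m bm.
have x10 : 0 < x - 1 by rewrite subr_gt0.
have B_lt : B / (x - 1) < b%:R.
  by apply: le_lt_trans (ler_norm _) _; apply: archi_boundP; apply: normr_ge0.
apply: le_trans (bern m); move: B_lt; rewrite ltr_pdivrMr // => B_lt.
have : b%:R * (x - 1) <= m%:R * (x - 1) by rewrite ler_wpM2r ?ler_nat // ltW.
lra.
Qed.

(** Take y = 1 + e and use (1 + e)^n <= 1 + (2^n - 1) e for 0 <= e <= 1. *)
Lemma exists_small_root (x : R) (n : nat) : 1 < x ->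
  exists2 y, 1 < y & y ^+ n <= x.
Proof.
move=> x1; pose e := Num.min 1 ((x - 1) / 2 ^+ n).
have e0 : 0 < e by rewrite lt_min ltr01 divr_gt0 ?subr_gt0 ?exprn_gt0.
have e1 : e <= 1 by rewrite ge_min lexx.
have ex : 2 ^+ n * e <= x - 1.
  by rewrite -ler_pdivlMl ?exprn_gt0 // mulrC ge_min lexx orbT.
exists (1 + e); first by rewrite ltrDl.
clearbody e.
suff : (1 + e) ^+ n <= 1 + (2 ^+ n - 1) * e by lra.
elim: n {ex} => [|n IH]; first by rewrite !expr0; lra.
rewrite !exprS; apply: (@le_trans _ _ ((1 + e) * (1 + (2 ^+ n - 1) * e))).
  by rewrite ler_pM2l //; lra.
have p1 : 0 <= 2 ^+ n - 1 :> R by rewrite subr_ge0 exprn_ege1 // ler1n.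
have : (2 ^+ n - 1) * e * e <= (2 ^+ n - 1) * e * 1.
  by rewrite ler_wpM2l // mulr_ge0 // ltW.
lra.
Qed.

Lemma geometric_dominated (a e s t : R) : 0 <= s -> s < t -> 0 < e ->
  exists m0, forall m, (m0 <= m)%N -> a * s ^+ m <= e * t ^+ m.
Proof.
move=> s0 st e0; have t0 : 0 < t by apply: le_lt_trans st.
have [->|s_neq0] := eqVneq s 0.
  exists 1%N => -[//|m] _; rewrite expr0n mulr0.
  by rewrite mulr_ge0 ?exprn_ge0 // ltW.
have s_gt0 : 0 < s by rewrite lt_def s_neq0.
have [m0 Hm0] := expr_unbounded (a / e) (x :=
  t / s) ltac:(by rewrite ltr_pdivlMr // mul1r).
exists m0 => m /Hm0; rewrite expr_div_n ler_pdivlMr ?exprn_gt0 //.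
by rewrite mulrAC ler_pdivrMr // mulrC [_ * e]mulrC [s ^+ m * a]mulrC.
Qed.

(** The modulus as an element of R; the norm on R[i] has its values in R[i]. *)
Definition nr (x : R[i]) : R := complex.Re `|x|.

Lemma nrE x : `|x| = (nr x)%:C.
Proof. by rewrite /nr RRe_real ?normr_real. Qed.

Lemma nr_ge0 x : 0 <= nr x.
Proof. by rewrite -lecR -nrE normr_ge0. Qed.

(** Each other term is eventually at most a fraction 1/(2n) of the dominant one, so together they
    cancel at most half of it. *)
Lemma dominant_growth (n : nat) (A z : 'I_n -> R[i]) (y : nat -> int) (j0 :
  'I_n) :
    (forall m, (y m)%:~R = \sum_j A j * z j ^+ m) ->
    A j0 != 0 -> (forall j, j != j0 -> `|z j| < `|z j0|) -> z j0 != 0 ->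
  exists2 b : R, 0 < b &
    exists m0, forall m, (m0 <= m)%N -> b * nr (z j0) ^+ m <= `|y m|%N%:R.
Proof.
move=> yA A0 z_dom z0.
have nrA0 : 0 < nr (A j0) by rewrite -ltcR -nrE normr_gt0.
have nrz0 : 0 < nr (z j0) by rewrite -ltcR -nrE normr_gt0.
pose e := nr (A j0) / 2 / n%:R.
have n_gt0 : (0 < n)%N by apply: leq_ltn_trans (ltn_ord j0).
have e0 : 0 < e by rewrite !divr_gt0 ?ltr0n.
have [m_ Hm] : exists m_ : 'I_n -> nat, forall j, j != j0 -> forall m, (m_ j <=
  m)%N ->
    nr (A j) * nr (z j) ^+ m <= e * nr (z j0) ^+ m.
  apply: (@fin_all_exists _ (fun=> nat) (fun j mj =>
    j != j0 -> forall m, (mj <= m)%N ->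
    nr (A j) * nr (z j) ^+ m <= e * nr (z j0) ^+ m)) => j.
  have [->|jj0] := eqVneq j j0; first by exists 0%N.
  have [m0 Hm0] := geometric_dominated (nr (A j)) (nr_ge0 (z j))
    (t := nr (z j0)) ltac:(by rewrite -ltcR -!nrE z_dom) e0.
  by exists m0.
exists (nr (A j0) / 2); first by rewrite divr_gt0.
exists (\max_j m_ j)%N => m mm.
have tail : \sum_(j | j != j0) nr (A j) * nr (z j) ^+ m <= nr (A j0) / 2 * nr
  (z j0) ^+ m.
  apply: (@le_trans _ _ (\sum_(j | j != j0) e * nr (z j0) ^+ m)).
    apply: ler_sum => j jj0; apply: Hm => //; apply: leq_trans mm; exact:
      leq_bigmax.
  apply: (@le_trans _ _ (\sum_(j < n) e * nr (z j0) ^+ m)).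
    rewrite [leRHS](bigD1 j0) //= lerDr mulr_ge0 ?exprn_ge0 ?nr_ge0 //; exact:
      ltW.
  rewrite sumr_const card_ord -[leLHS]mulr_natr [leLHS]mulrAC /e divfK //.
  by rewrite pnatr_eq0 -lt0n.
have : nr (A j0) * nr (z j0) ^+ m <=
    `|y m|%N%:R + \sum_(j | j != j0) nr (A j) * nr (z j) ^+ m.
  rewrite -lecR rmorphD rmorphM rmorphXn rmorph_sum /= -!nrE -normrX -normrM.
  have -> : (`|y m|%N%:R)%:C = `|(y m)%:~R : R[i]|.
    by rewrite -intr_norm -abszE rmorph_nat.
  have -> : A j0 * z j0 ^+ m = (y m)%:~R - \sum_(j | j != j0) A j * z j ^+ m.
    by rewrite yA (bigD1 j0) //= addrK.
  apply: le_trans (ler_normB _ _) _; rewrite lerD2l.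
  apply: le_trans (ler_norm_sum _ _ _) _; apply: ler_sum => j _.
  by rewrite rmorphM rmorphXn /= -!nrE normrM normrX.
move: tail; set S := \sum_(_ | _) _ => tail.
have -> : nr (A j0) * nr (z j0) ^+ m = nr (A j0) / 2 * nr (z j0) ^+ m + nr (A
  j0) / 2 * nr (z j0) ^+ m.
  by rewrite -mulrDl -splitr.
lra.
Qed.

End Growth.

Lemma recur_upper (n : nat) (c : 'I_n -> int) (y : nat -> int) : recur c y ->
  exists B W : nat, [/\ (0 < B)%N, (0 < W)%N & forall m, (`|y m| <= B * W ^
    m)%N].
Proof.
move=> y_rec; pose s := (\sum_(i < n) `|c i|)%N.
pose B := (\sum_(i < n) `|y i|).+1%N.
exists B, s.+1; split=> // m; elim/ltn_ind: m => m IH; case: (ltnP m n) => mn.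
  apply: (@leq_trans B); last by rewrite leq_pmulr // expn_gt0.
  by apply: leqW; rewrite (bigD1 (Ordinal mn)) //= leq_addr.
rewrite -(subnK mn) y_rec.
have -> : (B * s.+1 ^ (m - n + n) = B * s.+1 ^ m)%N by rewrite subnK.
case: m mn IH => [|m] mn IH.
  by rewrite big1 // => i _; have := ltn_ord i; lia.
apply: (@leq_trans (s * (B * s.+1 ^ m))); last first.
  by rewrite expnS mulnCA leq_mul2l leq_mul2r leqnSn !orbT.
rewrite big_distrl /=.
suff : `|\sum_(i < n) c i * y (m.+1 - n + i)%N| <=
    (\sum_(i < n) `|c i| * (B * s.+1 ^ m))%N%:Z by rewrite -abszE lez_nat.
apply: le_trans (ler_norm_sum _ _ _) _; rewrite -natz natr_sum; apply:
  ler_sum => i _.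
rewrite normrM -!abszE -PoszM natz lez_nat leq_mul2l; apply/orP; right.
have im : (m.+1 - n + i <= m)%N by have := ltn_ord i; lia.
apply: leq_trans (IH _ _) _; first by rewrite ltnS.
by rewrite leq_mul2l leq_pexp2l ?orbT.
Qed.

(** The Hankel matrix factors as V diag(A) V^T with V the Vandermonde matrix; in particular the
    dominant root does occur in the Binet formula. *)
Lemma hankel_coef_neq0 (F : numFieldType) (k : nat) (y : nat -> int)
    (A z : 'I_k.+1 -> F) :
  (forall m, (y m)%:~R = \sum_j A j * z j ^+ m) -> \det (hankel k y 0) != 0 ->
  forall j, A j != 0.
Proof.
move=> yA det_neq0 j.
have H_eq : map_mx intr (hankel k y 0) =
    Vandermonde k.+1 (\row_j z j) *m diag_mx (\row_j A j) *m
    (Vandermonde k.+1 (\row_j z j))^T.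
  apply/matrixP => i l; rewrite !mxE yA.
  apply: eq_bigr => r _; rewrite mul_mx_diag !mxE add0n exprD; ring.
apply: contra det_neq0 => Aj0; rewrite -(intr_eq0 F) -det_map_mx H_eq.
by rewrite !det_mulmx det_diag (bigD1 j) //= mxE (eqP Aj0) mul0r mulr0 mul0r.
Qed.

(** * Size of the terms divided by the window gcd *)

Section SizeBounds.

Variables (R : realType) (k : nat) (c : 'I_k.+1 -> int) (y : nat -> int).
Variables (z : 'I_k.+1 -> R[i]) (j0 : 'I_k.+1).
Hypotheses (k_gt0 : (0 < k)%N) (y_rec : recur c y) (c0 : c ord0 != 0).
Hypothesis det_neq0 : \det (hankel k y 0) != 0.
Hypothesis z_inj : injective z.
Hypothesis z_root : forall j, z j ^+ k.+1 = \sum_i (c i)%:~R * z j ^+ i.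
Hypothesis z_prod : \prod_j `|z j| = (`|c ord0|%N)%:R.
Hypothesis z_dom : forall j, j != j0 -> `|z j| < `|z j0|.

Lemma prod_nr_roots : \prod_j nr (z j) = (`|c ord0|%N)%:R.
Proof.
apply/(@complexI R); rewrite rmorph_prod rmorph_nat -z_prod.
by apply: eq_bigr => j _; rewrite nrE.
Qed.

(** |c_0| is the product of the moduli of all roots, and as k > 0 some root is strictly smaller than
    the dominant one. *)
Lemma const_coef_lt : (`|c ord0|%N)%:R < nr (z j0) ^+ k.+1.
Proof.
have dom j : j != j0 -> nr (z j) < nr (z j0).
  by move=> jj0; rewrite -ltcR -!nrE z_dom.
have [j1 j10] : exists j1, j1 != j0.
  have : (0 < #|[set~ j0]|)%N by rewrite cardsC1 card_ord.
  by rewrite card_gt0 => /set0Pn[j]; rewrite !inE; exists j.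
have nz0 : 0 < nr (z j0) by apply: le_lt_trans (dom _ j10); apply: nr_ge0.
rewrite -prod_nr_roots (bigD1 j0) //= exprS ltr_pM2l //.
have -> : nr (z j0) ^+ k = \prod_(j | j != j0) nr (z j0).
  rewrite prodr_const (_ : #|_| = k) //.
  by have := cardC1 j0; rewrite card_ord.
apply: ltr_prod; first by apply/hasP; exists j1; rewrite ?mem_index_enum.
by move=> j jj0; rewrite nr_ge0 dom.
Qed.

(** With d = k + 1, the gcd g satisfies g^d <= |c_0|^m De, while the terms are at least b rho^m. So
    the d-th power of the quotient is at least a constant times beta^m, where beta = rho^d / |c_0| >
    1. *)
Lemma size_bounds : exists (kap : R) (q m0 : nat), 1 < kap /\
  forall m h, (m0 <= m)%N -> (h <= m)%N ->
    [/\ (0 < window_gcd k y m)%N,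
     kap ^+ m <= (`|y (m + h)%N| %/ window_gcd k y m)%N%:R &
     (`|y (m + h)%N| %/ window_gcd k y m)%N%:R <= (kap ^+ m) ^+ q].
Proof.
have c0_ge1 : 1 <= (`|c ord0|%N)%:R :> R by rewrite ler1n absz_gt0.
have c0_gt0 := lt_le_trans ltr01 c0_ge1.
set rho := nr (z j0); pose d := k.+1.
have rho1 : 1 < rho.
  rewrite ltNge; apply/negP => rho_le1.
  have := lt_le_trans const_coef_lt (exprn_ile1 k.+1 (nr_ge0 _) rho_le1).
  by rewrite ltNge c0_ge1.
have rho_gt0 := lt_trans ltr01 rho1.
pose beta : R := rho ^+ d / (`|c ord0|%N)%:R.
have beta1 : 1 < beta by rewrite ltr_pdivlMr // mul1r const_coef_lt.
(* Taking kap^(2d) <= beta, and not just kap^d, leaves a factor (kap^m)^d to absorb the constants b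
   and [De]. *)
have [kap kap1 kapb] := exists_small_root (2 * d) beta1.
have kap_gt0 := lt_trans ltr01 kap1.
have [A yA] : exists A : 'I_k.+1 -> R[i], forall m, (y m)%:~R = \sum_j A j * z
  j ^+ m.
  apply: (binet z_inj z_root) => m; rewrite y_rec rmorph_sum.
  by apply: eq_bigr => i _; rewrite rmorphM.
have A_neq0 := hankel_coef_neq0 yA det_neq0.
have z0 : z j0 != 0 by rewrite -normr_gt0 nrE ltcR.
have [b b_gt0 [m1 low]] := dominant_growth yA (A_neq0 j0) z_dom z0.
pose De : R := (`|\det (hankel k y 0)|%N)%:R.
have De_gt0 : 0 < De by rewrite ltr0n absz_gt0.
have [m2 big] := expr_unbounded ((De + 1) / b ^+ d) kap1.
have [B [W [B_gt0 W_gt0 up]]] := recur_upper y_rec.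
(* Since h <= m, terms are at most B W^(2m), which for m >= 1 is at most (B W^2)^m. *)
have [q Hq] := expr_unbounded (B * W ^ 2)%N%:R kap1.
exists kap, q, (maxn 1 (maxn m1 m2)); split=> // m h.
rewrite !geq_max => /andP[m_ge1 /andP[m1m m2m]] hm.
set g := window_gcd k y m.
have g_dvd : (g %| `|y (m + h)%N|)%N by have := window_gcd_dvd y_rec m h;
  rewrite dvdzE.
have g_exp : (g ^ d <= `|c ord0| ^ m * `|\det (hankel k y 0)|)%N.
  rewrite -(absz_det_hankel y_rec); apply: dvdn_leq; last exact:
    window_gcd_exp_dvd.
  by rewrite (absz_det_hankel y_rec) muln_gt0 expn_gt0 !absz_gt0 c0.
have g_gt0 : (0 < g)%N.
  have := window_gcd_exp_dvd y_rec m; rewrite -/g; case: (g) => // /dvdnP[x].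
  rewrite exp0n // muln0 (absz_det_hankel y_rec) => /eqP.
  by rewrite muln_eq0 expn_eq0 !absz_eq0 (negbTE c0) (negbTE det_neq0).
split=> //.
- have low_y : b * rho ^+ m <= (`|y (m + h)%N| %/ g)%N%:R * g%:R.
    rewrite -natrM divnK //; apply: (@le_trans _ _ (b * rho ^+ (m + h))).
      by rewrite ler_pM2l // ler_eXn2l // leq_addr.
    by apply: low; apply: leq_trans m1m (leq_addr _ _).
  rewrite leNgt; apply/negP => a_small.
  have gd : (g%:R : R) ^+ d <= (`|c ord0|%N)%:R ^+ m * De.
    by rewrite -!natrX -natrM ler_nat.
  have : (b * rho ^+ m) ^+ d <= (kap ^+ m) ^+ d * ((`|c ord0|%N)%:R ^+ m * De).
    apply: (@le_trans _ _ (((`|y (m + h)%N| %/ g)%N%:R * g%:R) ^+ d)).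
      by rewrite lerXn2r ?nnegrE ?mulr_ge0 ?ler0n ?exprn_ge0 // ltW.
    rewrite exprMn; apply: ler_pM; rewrite ?exprn_ge0 ?ler0n //.
    by rewrite lerXn2r ?nnegrE ?ler0n ?exprn_ge0 // ltW.
  have rd : (rho ^+ m) ^+ d = beta ^+ m * (`|c ord0|%N)%:R ^+ m.
    by rewrite -exprMn /beta divfK ?gt_eqF // -!exprM mulnC.
  have c0m : 0 < (`|c ord0|%N)%:R ^+ m :> R by rewrite exprn_gt0.
  rewrite exprMn rd (_ : _ * (_ * De) = ((kap ^+ m) ^+ d * De) * (`|c
    ord0|%N)%:R ^+ m); last by ring.
  rewrite mulrA ler_pM2r // => b_le.
  have beta_ge : (kap ^+ m) ^+ d * (kap ^+ m) ^+ d <= beta ^+ m.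
    rewrite (_ : _ * _ = (kap ^+ (2 * d)) ^+ m); last first.
      by rewrite -exprD addnn -mul2n -!exprM [in RHS]mulnC.
    by rewrite lerXn2r ?nnegrE ?exprn_ge0 // ltW // (lt_trans ltr01).
  have k_gt : 0 < (kap ^+ m) ^+ d by rewrite !exprn_gt0.
  have bd_gt0 : 0 < b ^+ d by rewrite exprn_gt0.
  have : b ^+ d * (kap ^+ m) ^+ d <= De.
    rewrite -(ler_pM2l k_gt) mulrCA; apply: le_trans b_le.
    by rewrite ler_pM2l.
  apply/negP; rewrite -ltNge mulrC -ltr_pdivrMr //.
  apply: (@lt_le_trans _ _ ((De + 1) / b ^+ d)).
    by rewrite ltr_pM2r ?invr_gt0 // ltrDl.
  rewrite -exprM; apply: le_trans (big _ m2m) _.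
  by rewrite ler_eXn2l // leq_pmulr.
- apply: (@le_trans _ _ (B * W ^ (2 * m))%N%:R).
    rewrite ler_nat; apply: leq_trans (leq_div _ _) _; apply:
      leq_trans (up _) _.
    by rewrite leq_mul2l leq_pexp2l ?orbT //; lia.
  apply: (@le_trans _ _ ((B * W ^ 2)%N%:R ^+ m)).
    rewrite -natrX ler_nat expnMn -expnM leq_mul2r; apply/orP; right.
    by rewrite -{1}(expn1 B) leq_pexp2l.
  rewrite -exprM [(m * q)%N]mulnC exprM lerXn2r ?nnegrE ?ler0n ?exprn_ge0 ?(ltW
    kap_gt0) //.
  exact: Hq.
Qed.

End SizeBounds.

(** * Multiplicative relations and characteristic roots *)

(** Negative exponents are moved to the other side, which gives an equality of integers; valuations
    are then taken of the absolute values. *)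
Lemma logn_multiplicative_relation (F : numFieldType) (I : finType) (x :
  I -> int)
    (e : I -> int) :
  (forall i, x i != 0) -> \prod_i (x i)%:~R ^ e i = 1 :> F ->
  forall p, \sum_i e i * (logn p `|x i|)%:Z = 0.
Proof.
move=> x0 prod1 p.
pose a i : nat := if e i is Posz n then n else 0%N.
pose b i : nat := if e i is Negz n then n.+1 else 0%N.
have eab i : e i = (a i)%:Z - (b i)%:Z.
  by rewrite /a /b; case: (e i) => n; rewrite ?subr0 // sub0r NegzE.
have abZ : \prod_i x i ^+ a i = \prod_i x i ^+ b i.
  apply: (@intr_inj F); rewrite !rmorph_prod /=.
  transitivity (\prod_i (x i)%:~R ^ e i * \prod_i (x i ^+ b i)%:~R : F);
    last by rewrite prod1 mul1r.
  rewrite -big_split /=.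
  apply: eq_bigr => i _; rewrite !rmorphXn /= eab.
  have xi : (x i)%:~R != 0 :> F by rewrite intr_eq0.
  by rewrite !exprnP -expfzDr // subrK.
have := congr1 (logn p) (congr1 absz abZ).
rewrite !(big_morph absz abszM absz1) !logn_prodn; last first.
- by move=> i _; rewrite abszX expn_gt0 absz_gt0 x0.
- by move=> i _; rewrite abszX expn_gt0 absz_gt0 x0.
under eq_bigr do rewrite abszX lognX.
under [RHS]eq_bigr do rewrite abszX lognX.
move=> eqs; under eq_bigr do rewrite eab mulrBl.
rewrite sumrB; apply/eqP; rewrite subr_eq0; apply/eqP.
by have := congr1 Posz eqs; rewrite -!natz !natr_sum;
  under eq_bigr do rewrite natz PoszM;
   under [RHS]eq_bigr do rewrite natz PoszM.
Qed.

Lemma simple_roots_enum (R : realType) (k : nat) (c : 'I_k.+1 -> int) :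
    simple_roots R (char_poly_rec c) ->
  exists z : 'I_k.+1 -> R[i], injective z /\
    map_poly intr (char_poly_rec c) = \prod_j ('X - (z j)%:P).
Proof.
move=> simple; set fC : {poly R[i]} := map_poly _ _.
have f_monic := monic_char_poly_rec c.
have f_size := size_char_poly_rec c.
have fC_monic : fC \is monic by apply: monic_map.
have [rs fC_rs] := closed_field_poly_normal fC.
rewrite (monicP fC_monic) scale1r in fC_rs.
have size_rs : size rs = k.+1.
  have : size fC = k.+2 by rewrite size_map_poly_id0 ?f_size //
    (monicP f_monic) rmorph1 oner_neq0.
  by rewrite fC_rs size_prod_XsubC => -[].
have rs_uniq : uniq rs.
  apply: count_mem_uniq => a; have [ars|/count_memPn //] := boolP (a \in rs).
  have fC0 := monic_neq0 fC_monic.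
  apply/eqP; rewrite eqn_leq -has_count has_pred1 ars andbT -[nat_of_bool
    true]/1%N.
  rewrite -(simple a) ?[map_poly _ _]fC_rs ?root_prod_XsubC // -fC_rs.
  rewrite mup_geq // [X in _ %| X]fC_rs (bigID (pred1 a)) /= dvdp_mulr //.
  rewrite (eq_bigr (fun=> 'X - a%:P)) => [|z /eqP -> //].
  by rewrite big_const_seq iter_mulr_1.
exists (fun j => rs`_j); split.
  by move=> i j /eqP; rewrite nth_uniq ?size_rs // => /eqP/val_inj.
by rewrite fC_rs (big_nth 0) size_rs big_mkord.
Qed.

(** * Terms of low multiplicative rank *)

Section LowRankWindow.

Variables (R : realType) (k : nat) (c : 'I_k.+1 -> int) (y : nat -> int).
Variables (z : 'I_k.+1 -> R[i]) (j0 : 'I_k.+1).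
Hypotheses (k_gt0 : (0 < k)%N) (y_rec : recur c y) (c0 : c ord0 != 0).
Hypothesis det_neq0 : \det (hankel k y 0) != 0.
Hypothesis z_neq0 : forall j, z j != 0.
Hypothesis z_nondeg : forall m, (0 < m)%N -> injective (fun j => z j ^+ m).
Hypothesis z_root : forall j, z j ^+ k.+1 = \sum_i (c i)%:~R * z j ^+ i.
Hypothesis z_prod : \prod_j `|z j| = (`|c ord0|%N)%:R.
Hypothesis z_dom : forall j, j != j0 -> `|z j| < `|z j0|.

(** [card_low_rank] is applied to the quotients |y(m + h_i)| / g in rank r + 1, the additional
    dimension accounting for the common divisor g. *)
Lemma low_rank_window (r : nat) : exists t m0 L : nat,
  forall m N (h : 'I_t -> nat) (E : 'I_t -> 'I_r -> rat) (w :
    nat -> 'I_r -> rat),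
    (m0 <= m)%N -> (L * N <= m)%N -> (0 < N)%N -> (N <= m)%N ->
    injective h -> (forall i, (h i <= N)%N) ->
    ~ (forall i p, prime p ->
         (logn p `|y (m + h i)%N|)%:R = \sum_l E i l * w p l).
Proof.
have z_inj : injective z by move=> i j zij; apply: (z_nondeg (m := 1));
  rewrite //= !expr1.
have [kap [q [m0 [kap1 bounds]]]] :=
  size_bounds k_gt0 y_rec c0 det_neq0 z_inj z_root z_prod z_dom.
have [Z Zbound] := zero_bound c0 z_neq0 z_nondeg z_root.
(* This is the bound of [card_low_rank] in rank r + 1, so t indices already contradict it. *)
pose t := (r.+2 * (2 * (q * Z * r.+1)).+1)%N.
pose B := (\sum_i `|c i|).+1%N.
have cB i : (`|c i| <= B)%N by apply: leqW; rewrite (bigD1 i) //= leq_addr.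
(* V is chosen so that D^(2(r+1)) <= V^N; with kap^L >= V and L N <= m this is at most kap^m. *)
pose V := ((k.+1`! * (k.+1 * B) ^ k.+1) ^ (t ^ k.+1 * (2 * r.+1)))%N.
have [L VL] := expr_unbounded V%:R kap1.
exists t, (maxn 1 m0), L => m N h E w.
rewrite geq_max => /andP[m_gt0 m0m] LNm N_gt0 Nm h_inj hN Ew.
have X1 : 1 < kap ^+ m by rewrite exprn_egt1 // -lt0n.
pose g := window_gcd k y m.
have bnd i := bounds m (h i) m0m (leq_trans (hN i) Nm).
have t_gt0 : (0 < t)%N by rewrite muln_gt0.
have g_gt0 : (0 < g)%N by case: (bnd (Ordinal t_gt0)).
pose a i := (`|y (m + h i)%N| %/ g)%N.
have g_dvd i : (g %| `|y (m + i)%N|)%N.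
  by have := window_gcd_dvd y_rec m i; rewrite dvdzE.
have a_gt0 i : (0 < a i)%N.
  by case: (bnd i) => _ lo _; rewrite -(ltr_nat R); apply: lt_le_trans lo;
    apply: lt_trans X1.
pose D := minors_prod c h.
have D_gt0 : (0 < D)%N by apply: minors_prod_gt0.
pose v : 'cV[int]_k.+1 := \col_j (y (m + j)%N %/ g%:Z)%Z.
have v_state l : (compan c ^+ l *m v) ord0 0 * g%:Z = y (m + l)%N.
  have gv : g%:Z *: v = state k y m.
    apply/colP => j; rewrite !mxE mulrC divzK //; exact: window_gcd_dvd.
  have := companX_state m l y_rec; rewrite -gv -scalemxAr =>
    /matrixP/(_ ord0 ord0).
  by rewrite mxE [RHS]mxE addn0 => <-; rewrite mulrC.
have a_state i : a i = `|(compan c ^+ h i *m v) ord0 ord0|%N.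
  by rewrite /a -v_state abszM mulnK.
have few p : prime p -> (#|[set i | logn p D < logn p (a i)]| <= Z)%N.
  move=> p_pr; apply: leq_trans (few_large_valuations Zbound h_inj p_pr (v :=
    v) _).
    apply: subset_leq_card; apply/fintype.subsetP => i; rewrite !inE => vi.
    by rewrite dvdzE abszX -a_state pfactor_dvdn.
  have [j pj] := window_gcd_primitive y_rec g_gt0 p_pr.
  by exists j; rewrite mxE.
have D_le : D%:R ^+ (2 * r.+1) <= kap ^+ m.
  apply: (@le_trans _ _ ((V ^ N)%N%:R)).
    rewrite -natrX ler_nat.
    pose F := (k.+1`!)%N; pose P := ((k.+1 * B) ^ k.+1)%N.
    have Dle : (D <= (F * P ^ N) ^ (t ^ k.+1))%N.
      have := minors_prod_le (N := N) (isT : 0 < B)%N cB hN.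
      by rewrite card_ord /P -[((_ ^ k.+1) ^ N)%N]expnM [(k.+1 * N)%N]mulnC.
    have -> : (V ^ N = ((F * P) ^ N) ^ (t ^ k.+1 * (2 * r.+1)))%N.
      by rewrite /V -!expnM [(N * _)%N]mulnC.
    rewrite [leqRHS]expnM leq_exp2r // (leq_trans Dle) //
      leq_exp2r ?expn_gt0 ?t_gt0 //.
    by rewrite expnMn leq_mul2r; apply/orP; right;
      rewrite -{1}(expn1 F) leq_pexp2l ?fact_gt0.
  rewrite natrX; apply: (@le_trans _ _ ((kap ^+ L) ^+ N)).
    by rewrite lerXn2r ?nnegrE ?ler0n ?exprn_ge0 ?VL // ltW // (lt_trans ltr01).
  by rewrite -exprM ler_eXn2l.
(* The new coordinate has coefficient -1 and weight v_p(g), as v_p(a_i) = v_p(y(m + h_i)) -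
   v_p(g). *)
pose E' i (l : 'I_r.+1) : rat := if unlift ord0 l is Some l' then E i l' else
  -1.
pose w' p (l : 'I_r.+1) : rat := if unlift ord0 l is Some l' then w p l' else
  (logn p g)%:R.
have := @card_low_rank _ a D Z a_gt0 D_gt0 few R (kap ^+ m) r.+1 q E' w' X1.
rewrite card_ord ltnn => H; suff : false by []; apply: H => //.
- by move=> i; case: (bnd i).
- by move=> i; case: (bnd i).
move=> i p p_pr; rewrite big_ord_recl /E' /w' unlift_none.
under eq_bigr do rewrite liftK.
rewrite -Ew // mulN1r addrC; apply/eqP; rewrite eq_sym subr_eq -natrD.
by rewrite -lognM // /a divnK.
Qed.

End LowRankWindow.

(** * Counting tuples *)

(** The first exponent is nonzero, since otherwise the remaining entries would form a dependent
    proper sub-tuple; so the relation can be solved for the first entry, with coefficients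
    independent of p. *)
Lemma max_rank_exponents (F : numFieldType) (s : nat) (x : 'I_s.+1 -> int) :
    mult_dependent_max_rank (fun i => (x i)%:~R : F) ->
  exists E : 'I_s -> rat, forall p,
    (logn p `|x ord0|)%:R = \sum_l E l * (logn p `|x (lift ord0 l)|)%:R.
Proof.
case=> -[x0 [e [[i1 _ ei1] prod1]]] max_rank.
have x_neq0 i : x i != 0 by have := x0 i (finset.in_setT i); rewrite intr_eq0.
have prod_all : \prod_i (x i)%:~R ^ e i = 1 :> F.
  by rewrite -[RHS]prod1; apply: eq_bigl => i; rewrite finset.in_setT.
have e0 : e ord0 != 0.
  apply/negP => /eqP e00; pose J : {set 'I_s.+1} := [set~ ord0].
  have i1J : i1 \in J by rewrite !inE; apply: contraNneq ei1 => ->; rewrite e00.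
  apply: (max_rank J).
  - by apply/finset.set0Pn; exists i1.
  - by rewrite properT; apply/negP => /eqP/setP/(_ ord0); rewrite !inE eqxx.
  split=> [i _|]; first exact: x0.
  exists e; split; first by exists i1.
  rewrite -[RHS]prod_all [RHS](bigD1 ord0) //= e00 expr0z mul1r.
  by apply: eq_bigl => i; rewrite !inE.
exists (fun l => - (e (lift ord0 l))%:~R / (e ord0)%:~R) => p.
have e0Q : (e ord0)%:~R != 0 :> rat by rewrite intr_eq0.
have /eqP := logn_multiplicative_relation x_neq0 prod_all p.
rewrite big_ord_recl addr_eq0 => /eqP/(congr1 (intr : int -> rat)).
rewrite rmorphM rmorphN rmorph_sum /= => rel.
apply: (mulfI e0Q); rewrite mulr_sumr pmulrn rel -sumrN; apply: eq_bigr => l _.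
by rewrite rmorphM /= -pmulrn; field.
Qed.

(** Group the tuples by their tails: at most |B|^s tails, each with at most t heads. *)
Lemma card_tuple_fibres (T : finType) (s t : nat) (B : {set T})
    (A : {set s.+1.-tuple T}) :
    (forall n, n \in A -> forall i, tnth n i \in B) ->
    (forall tl : s.-tuple T, #|[set x | [tuple of x :: tl] \in A]| <= t)%N ->
  (#|A| <= #|B| ^ s * t)%N.
Proof.
move=> AB fib.
pose C := [set tl : s.-tuple T | [forall i, tnth tl i \in B]].
have cC : (#|C| <= #|B| ^ s)%N.
  pose f (tl : s.-tuple T) := [ffun i => tnth tl i].
  have f_inj : injective f.
    move=> a b /ffunP fab; apply: eq_from_tnth => i.
    by have := fab i; rewrite !ffunE.
  rewrite -(card_imset _ f_inj) -[s in (_ ^ s)%N]card_ord -card_ffun_on.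
  apply: subset_leq_card; apply/fintype.subsetP => _ /imsetP[tl tlC ->].
  apply/ffun_onP => i; rewrite ffunE; move: tlC; rewrite inE => /forallP; exact.
apply: leq_trans (leq_mul cC (leqnn t)).
rewrite -sum1_card -sum_nat_const.
rewrite (partition_big (fun n : s.+1.-tuple T =>
  [tuple of behead n]) (mem C)) /=.
  apply: leq_sum => tl _; rewrite sum1_card; apply: leq_trans (fib tl).
  have h_inj : {in [pred n | (n \in A) && ([tuple of behead n] == tl)] &,
      injective (fun n : s.+1.-tuple T => thead n)}.
    move=> a b; rewrite !inE => /andP[_ /eqP ea] /andP[_ /eqP eb] eh.
    apply/val_inj; rewrite [in LHS](tuple_eta a) [in RHS](tuple_eta b) /= eh.
    by congr (_ :: _); have := congr1 val (etrans ea (esym eb)).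
  rewrite -(card_in_imset h_inj); apply: subset_leq_card.
  apply/fintype.subsetP => x /imsetP[n]; rewrite inE => /andP[nA /eqP ntl] ->.
  by rewrite -ntl -tuple_eta.
move=> n nA; rewrite inE; apply/forallP => i.
by rewrite tnth_behead AB.
Qed.

Lemma card_window (M N : nat) :
  (#|[set x : 'I_(M + N).+1 | (M + 1 <= x)%N]| <= N)%N.
Proof.
apply: (@leq_trans #|[set (inord (M + 1 + j) : 'I_(M + N).+1) | j : 'I_N]|);
  last first.
  by apply: leq_trans (leq_imset_card _ _) _; rewrite card_ord.
apply: subset_leq_card; apply/fintype.subsetP => x; rewrite inE => Mx.
have jN : (x - (M + 1) < N)%N by have := ltn_ord x; lia.
apply/imsetP; exists (Ordinal jN) => //; apply/val_inj => /=.
by rewrite inordK subnKC.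
Qed.

(** * Consequences of the lower bound on M, and absorption of constants *)

Section LowerBoundOnM.

Variable R : realType.

(** Of the lower bound on M only M >= L N, for a constant L, will be used. Write N = e^x: the
    exponent is at least y = N ln 2 / x, and exp(y) >= (y/2)^2 with N >= x^3/27 suffices. *)
Lemma expR_iter_log_superlinear (L : nat) : exists N0 : nat, forall N : nat,
  (N0 <= N)%N ->
  (L * N)%:R <= expR (N%:R * iter_log 3 (N%:R : R) / iter_log 2 (N%:R : R)).
Proof.
pose l2 : R := ln 2.
have l2_gt0 : 0 < l2 by rewrite ln_gt0 // ltr1n.
(* Here 108 = 4 * 27, from (y/2)^2 = N * N (ln 2)^2 / (4 x^2) and N >= x^3/27. *)
pose K := Num.max 2 (108 * L%:R / l2 ^+ 2).
exists (Num.bound (expR K)) => N N0.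
have expK : expR K <= N%:R.
  apply/ltW/(lt_le_trans (archi_boundP (expR_ge0 K))).
  by rewrite ler_nat.
have N_gt0 : 0 < N%:R :> R by apply: lt_le_trans expK; apply: expR_gt0.
have [x xN] : exists x, N%:R = expR x :> R by exists (ln N%:R); rewrite lnK //
  posrE.
have Kx : K <= x by move: expK; rewrite xN ler_expR.
have x2 : 2 <= x by apply: le_trans Kx; rewrite le_max lexx.
have x_gt0 : 0 < x by apply: lt_le_trans x2.
have xL : 108 * L%:R / l2 ^+ 2 <= x by apply: le_trans Kx;
  rewrite le_max lexx orbT.
(* As x >= 2, log_2 N is ln x; the maxima with 2 ensure log_3 N >= ln 2. *)
rewrite /= [N%:R]xN expRK (max_idPl x2).
set l3 := ln (Num.max (ln x) 2).
have l3_ge : l2 <= l3 by rewrite ler_ln ?posrE ?lt_max ?ltr0n ?orbT //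
  le_max lexx orbT.
have lnx : ln x <= x by apply/ltW/ln_sublinear.
have lnx_gt0 : 0 < ln x by apply: ln_gt0; apply: lt_le_trans x2; rewrite ltr1n.
set e := expR x; have e_gt0 : 0 < e := expR_gt0 x.
have e_ge : x ^+ 3 / 27 <= e.
  have -> : e = expR (x / 3) ^+ 3.
    by rewrite -expRM_natl; congr expR; field.
  have -> : x ^+ 3 / 27 = (x / 3) ^+ 3 by field.
  rewrite lerXn2r ?nnegrE ?expR_ge0 ?divr_ge0 ?(ltW x_gt0) //.
  by apply: (@le_trans _ _ (1 + _)) (expR_ge1Dx _); rewrite lerDr.
have y_ge : e * l2 / x <= e * l3 / ln x.
  apply: ler_pM; rewrite ?mulr_ge0 ?invr_ge0 ?(ltW e_gt0) ?(ltW l2_gt0) ?(ltW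
    x_gt0) //.
    by rewrite ler_pM2l.
  by rewrite lef_pV2 ?posrE.
apply: le_trans (_ : expR (e * l2 / x) <= _); last by rewrite ler_expR.
set y := e * l2 / x; have y_ge0 : 0 <= y by rewrite !mulr_ge0 ?invr_ge0 // ltW.
apply: (@le_trans _ _ ((y / 2) ^+ 2)); last first.
  rewrite [y in leRHS]splitr expRD -expr2 lerXn2r ?nnegrE ?expR_ge0 ?(divr_ge0
    y_ge0) //.
  by apply: (@le_trans _ _ (1 + _)) (expR_ge1Dx _); rewrite lerDr.
rewrite natrM xN -/e.
have L_le : 108 * L%:R <= x * l2 ^+ 2 by rewrite -ler_pdivrMr // exprn_gt0.
have -> : (y / 2) ^+ 2 = e * (e * l2 ^+ 2 / (4 * x ^+ 2)).
  by rewrite /y; field; rewrite gt_eqF.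
rewrite mulrC ler_pM2l // ler_pdivlMr ?mulr_gt0 ?exprn_gt0 //.
apply: (@le_trans _ _ (x ^+ 3 / 27 * l2 ^+ 2)); last by rewrite ler_pM2r //
  exprn_gt0.
have : x ^+ 2 * (108 * L%:R) <= x ^+ 2 * (x * l2 ^+ 2) by rewrite ler_pM2l
  ?exprn_gt0.
lra.
Qed.

(** Once N >= t^(1/eps), the constant t is at most N^eps. *)
Lemma bounded_factor_le_powR (s t : nat) (eps : R) : 0 < eps ->
  exists N0 : nat, forall N : nat, (0 < N)%N -> (N0 <= N)%N ->
  (N ^ s * t)%N%:R <= (N%:R : R) `^ (s.+1%:R - 1 + eps).
Proof.
move=> eps0; exists (Num.bound (t%:R `^ eps^-1 : R)) => N N_gt0 N0.
have N_gt0R : 0 < N%:R :> R by rewrite ltr0n.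
have tN : t%:R `^ eps^-1 <= N%:R :> R.
  apply/ltW/(lt_le_trans (archi_boundP (powR_ge0 _ _))).
  by rewrite ler_nat.
rewrite -natr1 addrK powRD; last by rewrite (gt_eqF N_gt0R) implybT.
rewrite powR_mulrn ?ler0n // natrM natrX ler_pM2l ?exprn_gt0 //.
have : (t%:R `^ eps^-1) `^ eps <= N%:R `^ eps.
  by rewrite ge0_ler_powR ?nnegrE ?powR_ge0 ?ler0n ?(ltW eps0).
by rewrite -powRrM mulVf ?gt_eqF // powRr1 ?ler0n.
Qed.

End LowerBoundOnM.

(** * Roots of the characteristic polynomial *)

Section CharacteristicRoots.

Variables (R : realType) (k : nat) (c : 'I_k.+1 -> int) (z : 'I_k.+1 -> R[i]).
Hypothesis fC_prod :
  map_poly intr (char_poly_rec c) = \prod_j ('X - (z j)%:P) :> {poly R[i]}.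

Lemma horner_char_poly_rec (a : R[i]) :
  (map_poly intr (char_poly_rec c)).[a] =
  a ^+ k.+1 - \sum_i (c i)%:~R * a ^+ i.
Proof.
rewrite rmorphB rmorph_sum /= map_polyXn !hornerE horner_sum.
by congr (_ - _); apply: eq_bigr => i _; rewrite map_polyZ map_polyXn !hornerE.
Qed.

Lemma char_poly_rec0 : (char_poly_rec c)`_0 = - c ord0.
Proof.
rewrite coefB coefXn coef_sum (bigD1 ord0) //= big1 => [|i i0].
  by rewrite coefZ coefXn mulr1 addr0 sub0r.
by rewrite coefZ coefXn eq_sym -[_ == _]/(i == ord0) (negbTE i0) mulr0.
Qed.

Lemma root_charP a :
  reflect (exists j, a = z j) (root (map_poly intr (char_poly_rec c)) a).
Proof.
rewrite fC_prod -(big_map z xpredT (fun b => 'X - b%:P)) root_prod_XsubC.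
by apply: (iffP mapP) => [[j _ ->]|[j ->]]; exists j; rewrite ?mem_index_enum.
Qed.

Lemma char_rootE j : z j ^+ k.+1 = \sum_i (c i)%:~R * z j ^+ i.
Proof.
have /rootP : root (map_poly intr (char_poly_rec c)) (z j).
  by apply/root_charP; exists j.
by rewrite horner_char_poly_rec => /eqP; rewrite subr_eq0 => /eqP.
Qed.

Lemma prod_norm_roots : \prod_j `|z j| = (`|c ord0|%N)%:R.
Proof.
have := horner_char_poly_rec 0; rewrite fC_prod horner_prod expr0n sub0r /=.
rewrite [in RHS](bigD1 ord0) //= [X in - (_ + X)]big1 => [|i i0]; last first.
  by rewrite expr0n -[_ == _]/(i == ord0) (negbTE i0) mulr0.
rewrite expr0 mulr1 addr0 => /(congr1 Num.norm); rewrite normr_prod normrN.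
move=> e; have -> : (`|c ord0|%N)%:R = `|(c ord0)%:~R : R[i]|.
  by rewrite -intr_norm -abszE pmulrn.
by rewrite -e; apply: eq_bigr => j _; rewrite hornerXsubC sub0r normrN.
Qed.

Lemma root_neq0 j : c ord0 != 0 -> z j != 0.
Proof.
move=> c0; rewrite -normr_eq0; apply/negP => /eqP zj0.
have := prod_norm_roots; rewrite (bigD1 j) //= zj0 mul0r => /esym/eqP.
by rewrite pnatr_eq0 absz_eq0 (negbTE c0).
Qed.

End CharacteristicRoots.

(** * The bound for tuples of maximal rank *)

Theorem theorem1p3 (R : realType) (u : nat -> int) (d : nat) (c : 'I_d -> int)
    (hd : (2 <= d)%N)
    (hu : linear_recurrence u c)
    (hsimple : simple_roots R (char_poly_rec c))
    (hnondeg : nondegenerate_roots R (char_poly_rec c))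
    (hdom : has_dominant_root R (char_poly_rec c))
    (s : nat) (hs : (1 <= s)%N) :
  forall eps : R, 0 < eps ->
    exists N0 : nat, forall N M : nat, (1 <= N)%N -> (N0 <= N)%N ->
      expR (N%:R * iter_log 3 (N%:R : R) / iter_log 2 (N%:R : R)) <= M%:R ->
      (count_max_rank R u s M N)%:R <= (N%:R : R) `^ (s%:R - 1 + eps).
Proof.
move=> eps eps0.
case: d c hd hu hsimple hnondeg hdom => [//|[//|k]] c _ [_ u_rec u_min].
move=> simple [f0 nondeg] [lam lam_root lam_dom].
case: s hs => [//|s] _.
pose y n := u n.+1.
have y_rec : recur c y by move=> m; have := u_rec m.+1 isT; rewrite !addSn.
have y_min e (c' : 'I_e -> int) : (0 < e)%N -> (e < k.+2)%N -> ~ recur c' y.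
  move=> e0 ek c'_rec; apply: (u_min e c' e0 ek) => -[//|n] _.
  by have := c'_rec n.
have [z [z_inj fC_prod]] := simple_roots_enum simple.
have c0 : c ord0 != 0 by move: f0; rewrite char_poly_rec0 oppr_eq0.
have z_neq0 j : z j != 0 := root_neq0 fC_prod j c0.
have zP := root_charP fC_prod.
have [j0 lam_z] := zP _ lam_root; subst lam.
have z_dom j : j != j0 -> `|z j| < `|z j0|.
  move=> jj0; apply: lam_dom; first by apply/zP; exists j.
  by rewrite (inj_eq z_inj).
have z_nondeg m : (0 < m)%N -> injective (fun j => z j ^+ m).
  move=> m0 i j zij; apply/eqP/negPn/negP => ij.
  have /negP := nondeg (z i) (z j) ltac:(by apply/zP; exists i)
    ltac:(by apply/zP; exists j) ltac:(by rewrite (inj_eq z_inj)) m m0.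
  by apply; rewrite expr_div_n zij divff // expf_neq0.
have det_neq0 := det_hankel_neq0 y_rec (isT : 0 < k.+1)%N y_min.
have [t [m0 [L window]]] := low_rank_window (isT : 0 < k.+1)%N y_rec c0 det_neq0
  z_neq0 z_nondeg (char_rootE fC_prod) (prod_norm_roots fC_prod) z_dom s.
(* The window will start at M - 1; this constant makes M - 1 at least m0, L N and N, as N >= 1. *)
have [N1 N1P] := expR_iter_log_superlinear R (L + m0).+2.
have [N2 N2P] := bounded_factor_le_powR s t eps0.
exists (maxn N1 N2) => N M N_gt0; rewrite geq_max => /andP[N1N N2N] M_ge.
have M_big : ((L + m0).+2 * N <= M)%N.
  by rewrite -(ler_nat R); apply: le_trans (N1P _ N1N) M_ge.
apply: le_trans (N2P _ N_gt0 N2N); rewrite ler_nat.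
apply: (@leq_trans (#|[set x : 'I_(M + N).+1 | (M + 1 <= x)%N]| ^ s * t));
  last first.
  by rewrite leq_mul2r; apply/orP; right; case: (s) => // s';
    rewrite leq_exp2r ?card_window.
apply: card_tuple_fibres => [n|tl].
  by rewrite inE => /andP[/forallP n_ge _] i; rewrite inE.
(* Fix the last s entries. More than t possible first entries would supply t terms whose valuations
   lie in the span of those of s integers. *)
set S := [set x | _].
rewrite leqNgt; apply/negP => tS.
pose x (i : 'I_t) : nat := enum_val (widen_ord (ltnW tS) i).
have xS i : enum_val (widen_ord (ltnW tS) i) \in S := enum_valP _.
have x_bounds i : (M < x i <= M + N)%N.
  have := xS i; rewrite !inE => /andP[/forallP/(_ ord0)];
    rewrite tnth0 addn1 => -> _.
  by rewrite /= -ltnS ltn_ord.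
have x_inj : injective x.
  by move=> i j /val_inj/enum_val_inj/(congr1 val) /= /val_inj.
have E_ex i : exists E : 'I_s -> rat, forall p,
    (logn p `|u (x i)|)%:R = \sum_l E l * (logn p `|u (tnth tl l)|)%:R.
  have := xS i; rewrite !inE => /andP[_ /asboolP /max_rank_exponents[E EP]].
  exists E => p; have := EP p; rewrite tnth0 => ->.
  by apply: eq_bigr => l _; rewrite tnthS.
have [E EP] := fin_all_exists E_ex.
(* As y is u shifted by one, u(x) = y((M - 1) + (x - M)), with 1 <= x - M <= N. *)
apply: (window M.-1 N (fun i => x i - M)%N E (fun p l =>
  (logn p `|u (tnth tl l)|)%:R)).
- nia.
- nia.
- by [].
- nia.
- move=> i j; have := x_bounds i; have := x_bounds j => /andP[? _] /andP[? _] e.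
  by apply: x_inj; lia.
- by move=> i; have := x_bounds i; lia.
move=> i p _; rewrite -EP /y; congr (logn p `|u _|)%:R.
by have := x_bounds i; lia.
Qed.
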